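(* Let $r \in \{3,4,5\}$, let $p = p(n) \in [0,1]$, and let $d = d(n) = (n-(r-1))p$. If $d = \Theta(1)$, then with high probability $$\tau^{(r-1)}(H_r(n,p)) \leq (1+o(1))\,\beta_r(d)\binom{n}{r-1},$$ where $$\beta_r(d) = \begin{cases} \frac{1}{2}\left[1 - \exp\left(-\frac{d}{2}\left(1+e^{-d}\right)\right)\right] & \text{if } r = 3,\\ \frac{4}{9}\left[1 - \exp\left(-\frac{d}{3}\left(2+e^{-2d}\right)\right)\right] & \text{if } r = 4,\\ \frac{5}{16}\left[1 - \exp\left(-\frac{d}{2}\left(1+e^{-d}\right)\right)\right] & \text{if } r = 5.\end{cases}$$
   Context: An $r$-graph $G$ is a set of $r$-element subsets (edges) of a vertex set $V(G)$. An $(r-1)$-cover of $G$ is a collection of $(r-1)$-element subsets of $V(G)$ such that every edge of $G$ contains at least one member of the collection; $\tau^{(r-1)}(G)$ is the minimum size of an $(r-1)$-cover of $G$. $H_r(n,p)$ denotes the random $r$-graph on a set $V$ of $n$ labelled vertices in which each $r$-element subset of $V$ is an edge with probability $p$, independently of the others; $d$ is the expected number of edges containing a given $(r-1)$-set. $d = \Theta(1)$ means that $d$ is bounded above and bounded away from $0$ by positive constants for all large $n$. ''With high probability'' means with probability tending to $1$ as $n \to \infty$; here $o(1)$ denotes a deterministic quantity tending to $0$ as $n \to \infty$. *)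

(* Defs.v *)
From mathcomp Require Import all_boot all_order all_algebra.
From mathcomp Require Import all_classical all_reals all_analysis.

Set Implicit Arguments.
Unset Strict Implicit.
Unset Printing Implicit Defensive.

Import Order.TTheory GRing.Theory Num.Theory.
Import numFieldNormedType.Exports.

Local Open Scope ring_scope.

Definition ksubsets (V : finType) (k : nat) : {set {set V}} :=
  [set e : {set V} | #|e| == k]%SET.

Definition is_rgraph (V : finType) (r : nat) (G : {set {set V}}) : bool :=
  G \subset ksubsets V r.

Definition is_cover (V : finType) (k : nat) (G C : {set {set V}}) : bool :=
  (C \subset ksubsets V k) && [forall e in G, [exists f in C, f \subset e]].

(* The default [ksubsets V k] of the arg min is itself a k-cover of every
   r-graph with k <= r; see [tauP]. *)
Definition tau (V : finType) (k : nat) (G : {set {set V}}) : nat :=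
  #|[arg min_(C < ksubsets V k | is_cover k G C) #|C|]%N|.

Lemma tauP (V : finType) (r k : nat) (G : {set {set V}}) :
  (k <= r)%N -> is_rgraph r G ->
  (exists2 C, is_cover k G C & #|C| = tau k G) /\
  (forall C, is_cover k G C -> (tau k G <= #|C|)%N).
Proof.
move=> le_kr /fintype.subsetP rG; rewrite /tau.
have cov : is_cover k G (ksubsets V k).
  rewrite /is_cover subxx; apply/forall_inP => e /rG; rewrite inE => /eqP re.
  have [f fe kf] : exists2 f : {set V}, f \subset e & #|f| = k.
    have : (0 < 'C(#|e|, k))%N by rewrite re bin_gt0.
    rewrite -(cards_draws e k) card_gt0 => /set0Pn[f].
    by rewrite inE => /andP[fe /eqP kf]; exists f.
  by apply/exists_inP; exists f => //; rewrite inE kf.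
by case: arg_minnP => // C covC minC; split=> //; exists C.
Qed.

(* Probability that H_r(n,p), with vertex set 'I_n, satisfies E. *)
Definition Hr_pr (R : realType) (r n : nat) (p : R)
    (E : {set {set 'I_n}} -> bool) : R :=
  \sum_(G : {set {set 'I_n}} | is_rgraph r G && E G)
    \prod_(e in ksubsets 'I_n r) (if e \in G then p else 1 - p).

(* (n - (r-1)) p, the subtraction being that of R. *)
Definition mean_codeg (R : realType) (r : nat) (p : nat -> R) (n : nat) : R :=
  (n%:R - (r.-1)%:R) * p n.

Definition Theta1 (R : realType) (u : nat -> R) : Prop :=
  exists c C : R,
    [/\ 0 < c, 0 < C & \forall n \near \oo%classic, c <= u n <= C].

(* Only r = 3, 4, 5 are meaningful; the last value is a dummy. *)
Definition beta_r (R : realType) (r : nat) (d : R) : R :=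
  match r with
  | 3 => 1 / 2 * (1 - expR (- (d / 2) * (1 + expR (- d))))
  | 4 => 4 / 9 * (1 - expR (- (d / 3) * (2 + expR (- (2 * d)))))
  | 5 => 5 / 16 * (1 - expR (- (d / 2) * (1 + expR (- d))))
  | _ => 0
  end.

(* Main.v *)
Require Import Defs.
From mathcomp Require Import all_boot all_order all_algebra.
From mathcomp Require Import all_classical all_reals all_analysis.
From mathcomp Require Import ring lra zify.

Import Order.TTheory GRing.Theory Num.Theory.
Import numFieldNormedType.Exports.

(** Write [k = r - 1] and [N = 'C(n, k)]. Adding or removing an edge changes the
    cover number by at most one, so its variance is at most
    [p 'C(n, k.+1) = O(N)] and its deviations are negligible compared with [N]
    ([tau_whp]). It remains to construct a cover whose expected size is
    asymptotically at most [beta_r d * N].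

    Let [F] be a family of [k]-sets such that every [r]-set contains a member of
    [F]. Then [F] itself covers every [r]-graph, and the known constructions for
    Turan's problem give [F] of density [1/2] (two classes, [r = 3]), [4/9]
    (Turan's cyclic construction, [r = 4]) and [5/16] (Giraud's construction,
    [r = 5]). A random sparse [r]-graph does not need all of [F]. Call some of
    the extensions [f + w] of a member [f] primary for [f]. Take each [f] that
    has an edge of the graph among its primary extensions, and then, for every
    edge that contains no [f] taken so far, all members of [F] that it contains.
    This is a cover, whatever the choice of the primary extensions
    ([two_stage_coverP]).

    Suppose that a proportion [alpha] of the vertices are primary for [f], and
    that the other members of [F] inside a non-primary extension of [f] have
    together about [kappa n] primary extensions. A primary edge at [f] is absent
    with probability about [exp (- d alpha)]. A non-primary extension matters
    only if it is an edge and none of those [kappa n] sets is an edge, which has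
    probability about [p exp (- kappa d)]. By Harris' inequality these
    obstructions may be treated as if they were independent
    ([two_stage_cover_prob]), and [f] is taken with probability at most about
    [1 - exp (- d (alpha + (1 - alpha) exp (- kappa d)))] ([scheme_limit]).

    With [s = k] classes for [r = 3] and [r = 4], let [w] be primary for [f] if
    its class is not the majority class of [f]; then [alpha = (s - 1) / s], and
    [kappa = s - 1] because all [s] exchanges of a vertex of [f] for a
    non-primary vertex stay in [F]. In Giraud's construction, with the matrix
    given by the inner product on [F_2^K], let [w] be primary if [f] is the
    only member of [F] inside [f + w]; then [alpha = 1/2] and [kappa = 1], up
    to errors that vanish as [K] grows. These are the three values of
    [beta_r]. *)

Local Open Scope ring_scope.

(** * Expectation over independent coordinates *)

Section Expectation.
Context {R : realType} {T : finType}.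
Variable p : R.
Hypothesis p01 : 0 <= p <= 1.

Implicit Types (s : seq T) (f g : {set T} -> R) (G H : {set T}).

(** The expectation of [f] when, starting from [G], each entry of [s] is
    independently added with probability [p]. Integrating out one coordinate
    at a time makes the inequalities below inductions on [s] whose step is a
    statement about two-point distributions; [Ebern_sumE] is the comparison with
    the usual weighted sum. *)
Fixpoint Ebern (s : seq T) (f : {set T} -> R) (G : {set T}) : R :=
  if s is e :: s' then p * Ebern s' f (e |: G)%SET + (1 - p) * Ebern s' f G else f G.

Let p0 : 0 <= p. Proof. by case/andP: p01. Qed.
Let q0 : 0 <= 1 - p. Proof. by rewrite subr_ge0; case/andP: p01. Qed.

(** The random set can differ from [G] only at entries of [s]. *)
Lemma Ebern_ext s f g G :
  (forall H : {set T}, (forall x, x \notin s -> (x \in H) = (x \in G)) -> f H = g H) ->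
  Ebern s f G = Ebern s g G.
Proof.
elim: s G => [|e s IH] G fg /=; first exact: fg.
congr (_ * _ + _ * _); apply: IH => H HG; apply: fg => x;
  rewrite inE negb_or => /andP[xe xs]; rewrite HG //.
by rewrite !inE (negbTE xe).
Qed.

Lemma Ebern_le s f g G : (forall H, f H <= g H) -> Ebern s f G <= Ebern s g G.
Proof.
by move=> fg; elim: s G => [|e s IH] G //=; apply: lerD; apply: ler_wpM2l.
Qed.

Lemma Ebern_le_in s f g G :
  (forall H : {set T}, (forall x, x \notin s -> (x \in H) = (x \in G)) -> f H <= g H) ->
  Ebern s f G <= Ebern s g G.
Proof.
elim: s G => [|e s IH] G fg /=; first exact: fg.
apply: lerD; apply: ler_wpM2l => //; apply: IH => H HG; apply: fg => x;
  rewrite inE negb_or => /andP[xe xs]; rewrite HG //.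
by rewrite !inE (negbTE xe).
Qed.

Lemma Ebern_cst s c G : Ebern s (fun=> c) G = c.
Proof. by elim: s G => [|e s IH] G //=; rewrite !IH; ring. Qed.

Lemma EbernD s f g G : Ebern s (fun H => f H + g H) G = Ebern s f G + Ebern s g G.
Proof. by elim: s G => [|e s IH] G //=; rewrite !IH; ring. Qed.

Lemma EbernZ s c f G : Ebern s (fun H => c * f H) G = c * Ebern s f G.
Proof. by elim: s G => [|e s IH] G //=; rewrite !IH; ring. Qed.

Lemma Ebern_sum (I : Type) (r : seq I) (P : pred I) (f : I -> {set T} -> R) s G :
  Ebern s (fun H => \sum_(i <- r | P i) f i H) G = \sum_(i <- r | P i) Ebern s (f i) G.
Proof.
elim: s G => [|e s IH] G //=; rewrite !IH !mulr_sumr -big_split //=.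
Qed.

Lemma Ebern_prod s (phi : T -> bool -> R) G : uniq s ->
  (forall e, e \in s -> e \notin G) ->
  Ebern s (fun H => \prod_(e <- s) phi e (e \in H)) G =
  \prod_(e <- s) (p * phi e true + (1 - p) * phi e false).
Proof.
elim: s G => [|e s IH] G /=; first by rewrite !big_nil.
move=> /andP[es us] sG; have eG : e \notin G by apply: sG; rewrite inE eqxx.
have step (K : {set T}) : (forall x, x \in s -> x \notin K) ->
  Ebern s (fun H => \prod_(x <- e :: s) phi x (x \in H)) K =
  phi e (e \in K) * \prod_(x <- s) (p * phi x true + (1 - p) * phi x false).
  move=> sK; rewrite -(IH K) // -EbernZ; apply: Ebern_ext => H HK.
  by rewrite big_cons HK.
rewrite !step ?setU11 ?(negbTE eG) ?big_cons; first by ring.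
  by move=> x xs; apply: sG; rewrite inE xs orbT.
move=> x xs; rewrite !inE negb_or sG ?inE ?xs ?orbT // andbT.
by apply: contraNneq es => <-.
Qed.

Lemma Ebern_lipschitz s f G e : (forall H x, `|f (x |: H)%SET - f H| <= 1) ->
  `|Ebern s f (e |: G)%SET - Ebern s f G| <= 1.
Proof.
move=> lip; elim: s G => [|x s IH] G //=; rewrite finset.setUCA.
have := IH (x |: G)%SET; have := IH G; rewrite !ler_norml finset.setUCA.
move: (Ebern s f _) (Ebern s f _) (Ebern s f _) (Ebern s f _) => a b c d.
move=> /andP[/(ler_wpM2l q0) h1 /(ler_wpM2l q0) h2] /andP[/(ler_wpM2l p0) h3 /(ler_wpM2l p0) h4].
by apply/andP; split; lra.
Qed.

(** Each coordinate contributes at most [p (1 - p)] to the variance, as the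
    two conditional means that it separates are at distance at most 1. *)
Lemma Ebern_var s f G : (forall H x, `|f (x |: H)%SET - f H| <= 1) ->
  Ebern s (fun H => f H ^+ 2) G - Ebern s f G ^+ 2 <= (size s)%:R * p.
Proof.
move=> lip; elim: s G => [|e s IH] G /=; first by rewrite subrr mul0r.
have := Ebern_lipschitz s f G e lip; have := IH (e |: G)%SET; have := IH G.
set b := Ebern s f _; set a := Ebern s f _; set b2 := Ebern s _ _; set a2 := Ebern s _ _.
move: a b a2 b2 => a b a2 b2.
rewrite -natr1 => hb ha; rewrite -ler_sqr ?nnegrE // real_normK ?num_real // expr1n => hab.
have hp1 := ler_wpM2l p0 ha; have hq1 := ler_wpM2l q0 hb.
have hpq : p * (1 - p) * (a - b) ^+ 2 <= p * (1 - p).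
  by apply: ler_piMr hab; exact: (mulr_ge0 p0 q0).
by have := sqr_ge0 p; lra.
Qed.

(** Monotonicity with a prescribed sense for each coordinate: decreasing in
    the coordinates of [S], increasing in all others. *)
Definition directed (S : {set T}) (f : {set T} -> R) :=
  forall e H, if e \in S then f (e |: H)%SET <= f H else f H <= f (e |: H)%SET.

Lemma Ebern_directed S s f : directed S f -> directed S (Ebern s f).
Proof.
move=> df; elim: s => [|x s IH] //= e H; have := IH e H; have := IH e (x |: H)%SET.
rewrite finset.setUCA; case: ifP => _ h1 h2; by apply: lerD; apply: ler_wpM2l.
Qed.

(** Harris' inequality: functions monotone in the same sense in every
    coordinate are positively correlated, because the two increments of the
    inductive step have the same sign. *)
Lemma Ebern_harris S s f g G : directed S f -> directed S g ->
  Ebern s f G * Ebern s g G <= Ebern s (fun H => f H * g H) G.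
Proof.
move=> df dg; elim: s G => [|e s IH] G //=.
have := Ebern_directed S s f df e G; have := Ebern_directed S s g dg e G.
have := IH G; have := IH (e |: G)%SET.
set a := Ebern s f _; set b := Ebern s f _; set a' := Ebern s g _; set b' := Ebern s g _.
set c := Ebern s _ _; set c' := Ebern s _ _; move: a b a' b' c c' => a b a' b' c c' hc hc'.
have hp1 := ler_wpM2l p0 hc; have hq1 := ler_wpM2l q0 hc'.
have pq : 0 <= p * (1 - p) by apply: mulr_ge0.
case: ifP => _ h1 h2.
  have := mulr_ge0 pq (mulr_ge0 (x := b - a) (y := b' - a') _ _).
  by rewrite !subr_ge0 => /(_ h2 h1); nra.
have := mulr_ge0 pq (mulr_ge0 (x := a - b) (y := a' - b') _ _).
by rewrite !subr_ge0 => /(_ h2 h1); nra.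
Qed.

Lemma directed_prod S (I : Type) (r : seq I) (P : pred I) (f : I -> {set T} -> R) :
  (forall i H, 0 <= f i H) -> (forall i, P i -> directed S (f i)) ->
  directed S (fun H => \prod_(i <- r | P i) f i H).
Proof.
move=> f0 df e H; have [eS|eS] := boolP (e \in S); apply: ler_prod => i Pi;
  by rewrite f0 /=; have := df i Pi e H; rewrite ?eS ?(negbTE eS).
Qed.

Lemma Ebern_harris_prod S (I : Type) (r : seq I) (P : pred I) (f : I -> {set T} -> R) s G :
  (forall i H, 0 <= f i H) -> (forall i, P i -> directed S (f i)) ->
  \prod_(i <- r | P i) Ebern s (f i) G <= Ebern s (fun H => \prod_(i <- r | P i) f i H) G.
Proof.
move=> f0 df; elim: r => [|i r IH].
  rewrite big_nil -[X in X <= _](Ebern_cst s 1 G).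
  by apply: Ebern_le => H; rewrite big_nil.
rewrite big_cons; case: ifP => Pi; last first.
  by apply: le_trans IH _; apply: Ebern_le => H; rewrite big_cons Pi.
have Ei0 : 0 <= Ebern s (f i) G by rewrite -(Ebern_cst s 0 G); apply: Ebern_le.
apply: le_trans (ler_wpM2l Ei0 IH) _.
apply: le_trans (Ebern_harris S s _ _ G (df i Pi) (directed_prod S I r P f f0 df)) _.
by apply: Ebern_le => H; rewrite big_cons Pi.
Qed.

Lemma Ebern_sumE s f G : uniq s -> (forall e, e \in s -> e \notin G) ->
  Ebern s f G = \sum_(H : {set T} | H \subset [set x in s]%SET)
     (\prod_(e <- s) (if e \in H then p else 1 - p)) * f (H :|: G)%SET.
Proof.
elim: s G => [|e s IH] G /=.
  move=> _ _; rewrite (big_pred1 finset.set0) ?big_nil ?mul1r ?finset.set0U // => H /=.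
  by rewrite (_ : [set x in [::]]%SET = finset.set0) ?finset.subset0 //; apply/setP => x; rewrite !inE.
move=> /andP[es us] sG; have eG : e \notin G by apply: sG; rewrite inE eqxx.
have sG' x : x \in s -> x \notin G by move=> xs; apply: sG; rewrite inE xs orbT.
have sG1 x : x \in s -> x \notin (e |: G)%SET.
  move=> xs; rewrite !inE negb_or sG' // andbT.
  by apply: contraNneq es => <-.
have subE (H : {set T}) : (H \subset [set x in e :: s])%SET =
    (H :\ e \subset [set x in s])%SET.
  apply/fintype.subsetP/fintype.subsetP => sub x.
    by rewrite !inE => /andP[xe /sub]; rewrite !inE (negbTE xe).
  move=> xH; have := sub x; rewrite !inE xH andbT.
  by case: eqP => //= _; apply.
have subN (H : {set T}) : (H \subset [set x in s])%SET -> e \notin H.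
  by move=> /fintype.subsetP sub; apply: contra es => /sub; rewrite inE.
rewrite !IH // [RHS](bigID (fun H : {set T} => e \in H)) /=; congr (_ + _).
- rewrite [RHS](reindex_onto (fun H : {set T} => (e |: H)%SET) (fun H : {set T} => (H :\ e)%SET)) /=; last first.
    by move=> H /andP[_ eH]; rewrite finset.setD1K.
  rewrite mulr_sumr; apply: eq_big => [H|H sH].
    rewrite subE setU11 andbT.
    apply/idP/andP => [sH|[sub /eqP <-]] //.
    by rewrite finset.setU1K ?subN.
  rewrite big_cons setU11 mulrA; congr (_ * _); last first.
    by rewrite finset.setUCA finset.setUA.
  congr (_ * _); apply: eq_big_seq => x xs; rewrite !inE.
  by case: eqP => // xe; rewrite xe (negbTE es) in xs.
- rewrite mulr_sumr; apply: eq_big => [H|H sH].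
    rewrite subE; apply/idP/andP => [sH|[sub eH]].
      split; last exact: subN.
      exact: fintype.subset_trans (finset.subsetDl _ _) sH.
    suff -> : H = (H :\ e)%SET by [].
    apply/setP => x; rewrite !inE; case: eqP => //= ->; exact/negbTE.
  by rewrite big_cons (negbTE (subN _ sH)) mulrA.
Qed.

Lemma Ebern_chebyshev s f G V t : 0 < t ->
  Ebern s (fun H => f H ^+ 2) G - Ebern s f G ^+ 2 <= V ->
  Ebern s (fun H => (Ebern s f G + t < f H)%R%:R) G <= V / t ^+ 2.
Proof.
move=> t0 hV; set m := Ebern s f G.
rewrite ler_pdivlMr ?exprn_gt0 // mulrC -EbernZ.
apply: le_trans hV.
have -> : Ebern s (fun H => f H ^+ 2) G - m ^+ 2 = Ebern s (fun H => f H ^+ 2 + (- (2 * m) * f H + m ^+ 2)) G.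
  by rewrite !EbernD EbernZ Ebern_cst -/m; ring.
apply: Ebern_le => H; case: ltP => [h|_] /=; last first.
  have := sqr_ge0 (f H - m); nra.
have h2 : t <= f H - m by lra.
have := lerXn2r 2 _ _ h2; rewrite !nnegrE => /(_ (ltW t0)) h3.
have := h3 (le_trans (ltW t0) h2); nra.
Qed.

End Expectation.

(** * Covers from covering systems *)

Section HrEx.
Variable R : realType.

Lemma Hr_prE (n r : nat) (p : R) (E : {set {set 'I_n}} -> bool) :
  Hr_pr r p E = Ebern p (enum (ksubsets 'I_n r)) (fun G => (E G)%:R) finset.set0.
Proof.
rewrite Ebern_sumE ?enum_uniq //; last by move=> e _; rewrite inE.
rewrite /Hr_pr (_ : [set x in _]%SET = ksubsets 'I_n r); last first.
  by apply/setP => x; rewrite inE mem_enum.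
rewrite big_mkcondr /=; apply: eq_bigr => G _.
by rewrite big_enum finset.setU0; case: (E G); rewrite ?mulr1 ?mulr0.
Qed.

End HrEx.

Lemma ler_bool (R : numDomainType) (b c : bool) : b ==> c -> b%:R <= c%:R :> R.
Proof. by case: b c => [] [] //= _; rewrite ler01. Qed.

Section TauLipschitz.
Variables (V : finType) (k : nat).
Local Notation S := (ksubsets V k.+1).

(** One more edge needs at most one more set in the cover. The intersection
    with the [k.+1]-sets makes the estimate hold for arbitrary families. *)
Lemma tau_lipschitz (G : {set {set V}}) e :
  (tau k ((e |: G) :&: S)%SET <= (tau k (G :&: S)%SET).+1)%N /\
  (tau k (G :&: S)%SET <= tau k ((e |: G) :&: S)%SET)%N.
Proof.
have rS H : is_rgraph k.+1 (H :&: S)%SET by apply: finset.subsetIr.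
have [[C covC <-] minC] := tauP (leqnSn k) (rS G).
have [[C' covC' cC'] minC'] := tauP (leqnSn k) (rS (e |: G)%SET).
split; last first.
  rewrite -cC'; apply: minC.
  move: covC' => /andP[kC /forall_inP cov]; rewrite /is_cover kC /=.
  by apply/forall_inP => x /finset.setIP[xG xS]; apply: cov; rewrite finset.in_setI in_setU1 xG orbT.
have [eS|eS] := boolP (e \in S); last first.
  rewrite leqW // minC' //.
  suff -> : ((e |: G) :&: S = G :&: S)%SET by [].
  apply/setP => x; rewrite inE [RHS]inE in_setU1.
  by case: eqP => //= ->; rewrite (negbTE eS) andbF.
have [f fe kf] : exists2 f : {set V}, f \subset e & #|f| = k.
  have : (0 < 'C(#|e|, k))%N.
    by rewrite bin_gt0; move: eS; rewrite inE => /eqP ->.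
  rewrite -(cards_draws e k) card_gt0 => /set0Pn[f].
  by rewrite inE => /andP[fe /eqP kf]; exists f.
apply: leq_trans (minC' (f |: C)%SET _) _; last first.
  by rewrite cardsU1; case: (_ \notin _); rewrite ?add1n ?add0n.
move: covC => /andP[kC /forall_inP cov]; apply/andP; split.
  apply/fintype.subsetP => x; rewrite in_setU1 => /predU1P[->|/(fintype.subsetP kC)//].
  by rewrite inE kf.
apply/forall_inP => x; rewrite finset.in_setI in_setU1 => /andP[/predU1P[->|xG] xS].
  by apply/exists_inP; exists f; rewrite ?setU11.
have xGS : x \in (G :&: S)%SET by rewrite finset.in_setI xG.
have /exists_inP[g gC gx] := cov x xGS.
by apply/exists_inP; exists g => //; rewrite in_setU1 gC orbT.
Qed.

End TauLipschitz.

Section Cover.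
Variables (V : finType) (k : nat) (F : {set {set V}}) (U : {set V} -> V -> bool).
Hypothesis FK : F \subset ksubsets V k.
Hypothesis turanF : forall e : {set V}, #|e| = k.+1 -> exists2 f, f \in F & f \subset e.

(** [U f w] marks the extensions [f + w] of [f] that are primary for [f]:
    edges that [f] is made responsible for at once. All other edges above [f]
    are left to be covered by chance. *)
Definition primary_hit (G : {set {set V}}) (f : {set V}) :=
  [exists w, [&& w \notin f, U f w & (w |: f)%SET \in G]].

(** The second alternative concerns edges whose other members of [F] were not
    taken for a primary edge: such an edge contributes all its members of [F].
    This makes the family a cover whatever [U] is. *)
Definition two_stage_cover (G : {set {set V}}) : {set {set V}} :=
  [set f in F | primary_hit G f ||
    [exists v, [&& v \notin f, (v |: f)%SET \in G &
      [forall f' in F, (f' \subset (v |: f)%SET) && (f' != f) ==> ~~ primary_hit G f']]]]%SET.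

(** The primary edges of the other members of [F] inside [f + v]. If one of
    them is present, the edge [f + v] does not force [f] into the cover. A
    primary edge [f + v] always does, hence the value [set0] in that case. *)
Definition rescuers (f : {set V}) (v : V) : {set {set V}} :=
  if U f v then finset.set0 else
  [set e | [exists f' in F, [exists w,
    [&& f' \subset (v |: f)%SET, f' != f, w \notin (v |: f)%SET, U f' w & e == (w |: f')%SET]]]]%SET.

Lemma cardF f : f \in F -> #|f| = k.
Proof. by move=> /(fintype.subsetP FK); rewrite inE => /eqP. Qed.

Lemma two_stage_coverP G : is_rgraph k.+1 G -> is_cover k G (two_stage_cover G).
Proof.
move=> rG; apply/andP; split.
  by apply: fintype.subset_trans _ FK; apply/fintype.subsetP => f; rewrite inE => /andP[].
apply/forall_inP => e eG.
have ce : #|e| = k.+1 by have := fintype.subsetP rG e eG; rewrite inE => /eqP.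
have [/exists_inP[f fF /andP[fe hf]]|] :=
  boolP [exists f in F, (f \subset e) && primary_hit G f].
  by apply/exists_inP; exists f => //; rewrite inE fF hf.
move=> /exists_inPn nohit.
have [f fF fe] := turanF e ce.
apply/exists_inP; exists f => //; rewrite inE fF /=; apply/orP; right.
have : (0 < #|e :\: f|)%N by rewrite cardsDS // ce (cardF f fF) subSnn.
rewrite card_gt0 => /set0Pn[v]; rewrite finset.in_setD => /andP[vf ve].
have defe : e = (v |: f)%SET.
  apply/eqP; rewrite eq_sym eqEcard cardsU1 vf ce (cardF f fF) leqnn andbT.
  by apply/fintype.subsetP => x; rewrite in_setU1 => /predU1P[->//|/(fintype.subsetP fe)].
apply/existsP; exists v; rewrite vf -defe eG /=.
apply/forall_inP => f' f'F; apply/implyP => /andP[f'e _].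
by have := nohit f' f'F; rewrite f'e.
Qed.

Lemma two_stage_cover_miss G f : f \in two_stage_cover G ->
  exists v, [/\ v \notin f, (v |: f)%SET \in G & [disjoint rescuers f v & G]].
Proof.
rewrite inE /rescuers => /andP[fF /orP[/existsP[w /and3P[wf Ufw wG]]|]].
  exists w; rewrite wf wG Ufw; split=> //.
  by apply/fintype.pred0P => x /=; rewrite inE.
move=> /existsP[v /and3P[vf vG /forall_inP nohit]]; exists v; rewrite vf vG; split=> //.
case: ifP => _; first by apply/fintype.pred0P => x /=; rewrite inE.
apply/fintype.pred0P => x /=; apply/negP => /andP[].
rewrite inE => /exists_inP[f' f'F /existsP[w /and5P[f's f'f wv Uw /eqP ->]]] xG.
have := nohit f' f'F; rewrite f's f'f /= => /existsPn/(_ w)/negP; apply.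
rewrite Uw xG !andbT; apply: contra wv; exact: (fintype.subsetP f's).
Qed.

Lemma mem_rescuers f v e : f \in F -> e \in rescuers f v ->
  [/\ #|e| = k.+1, e != (v |: f)%SET & ~~ (f \subset e)].
Proof.
move=> fF; rewrite /rescuers; case: ifP => _; first by rewrite inE.
rewrite inE => /exists_inP[f' f'F /existsP[w /and5P[f's f'f wv Uw /eqP ->]]].
have wf' : w \notin f' by apply: contra wv; exact: (fintype.subsetP f's).
split; first by rewrite cardsU1 wf' (cardF f' f'F).
  by apply: contraNneq wv => <-; rewrite setU11.
apply: contra f'f => /fintype.subsetP sub.
rewrite eq_sym eqEcard (cardF f fF) (cardF f' f'F) leqnn andbT.
apply/fintype.subsetP => x xf; have := sub x xf; rewrite in_setU1 => /predU1P[xw|//].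
by move: wv; rewrite -xw in_setU1 xf orbT.
Qed.

(** A rescuer [w + f'] with [w] outside [f + v] determines [f'], as its trace
    on [f + v], and [w]; so different pairs give different edges. *)
Lemma rescuers_ge f v (A : {set {set V}}) : ~~ U f v ->
  (forall f', f' \in A -> [/\ f' \in F, f' \subset (v |: f)%SET & f' != f]) ->
  (\sum_(f' in A) #|[set w | (w \notin (v |: f)%SET) && U f' w]%SET| <= #|rescuers f v|)%N.
Proof.
move=> nU hA.
pose P := [set x : {set V} * V | (x.1 \in A) && ((x.2 \notin (v |: f)%SET) && U x.1 x.2)]%SET.
have inj : {in P &, injective (fun x : {set V} * V => (x.2 |: x.1)%SET)}.
  move=> [f1 w1] [f2 w2]; rewrite !inE /= => /andP[/hA[_ s1 _] /andP[n1 _]].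
  move=> /andP[/hA[_ s2 _] /andP[n2 _]] e12.
  (* both components are recovered from the union and f + v *)
  have key (g : {set V}) w : g \subset (v |: f)%SET -> ~~ ((w == v) || (w \in f)) ->
     g = ((w |: g) :&: (v |: f))%SET /\ [set w]%SET = ((w |: g) :\: (v |: f))%SET.
    move=> /fintype.subsetP sg nw.
    have sg' x : x \in g -> (x == v) || (x \in f) by move=> /sg; rewrite !inE.
    have wg : (w \in g) = false by apply/negbTE; apply: contra nw => /sg'.
    split; apply/setP => x; rewrite !inE; have [->|_] := eqVneq x w;
      rewrite ?wg ?(negbTE nw) //=; have [/sg' ->|] := boolP (x \in g);
      by rewrite ?andbF.
  have [E1 W1] := key f1 w1 s1 n1; have [E2 W2] := key f2 w2 s2 n2.
  have /set1_inj -> : [set w1]%SET = [set w2]%SET by rewrite W1 W2 e12.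
  by congr (_, _); rewrite [LHS]E1 e12 -E2.
apply: (@leq_trans #|P|).
  rewrite -[leqRHS]sum1_card.
  under eq_bigr => f' _ do rewrite -sum1_card.
  by rewrite pair_big_dep /=; apply/eq_leq/eq_bigl => x; rewrite !inE.
rewrite -(card_in_imset inj) /rescuers (negbTE nU); apply: subset_leq_card.
apply/fintype.subsetP => e /imsetP[[f' w]]; rewrite inE /= => /and3P[/hA[f'F s' n'] wn Uw] ->.
by rewrite inE; apply/exists_inP; exists f' => //; apply/existsP; exists w; rewrite s' n' wn Uw eqxx.
Qed.

Section Prob.
Variables (R : realType) (p : R).
Hypothesis p01 : 0 <= p <= 1.
Local Notation S := (enum (ksubsets V k.+1)).

(** The two events concern disjoint sets of coordinates. *)
Lemma Ebern_hit_avoid e (D : {set {set V}}) : e \in ksubsets V k.+1 ->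
  D \subset ksubsets V k.+1 -> e \notin D ->
  Ebern p S (fun G => ((e \in G) && [disjoint D & G])%:R) finset.set0 = p * (1 - p) ^+ #|D|.
Proof.
move=> eS DS eD.
pose phi x (b : bool) : R := if x == e then b%:R else if x \in D then (~~ b)%:R else 1.
transitivity (Ebern p S (fun G => \prod_(x <- S) phi x (x \in G)) finset.set0).
  apply: Ebern_ext => G _; have [/andP[eG dG]|] := boolP (_ && _).
    rewrite big1_seq // => x _; rewrite /phi; case: eqP => [->|_]; first by rewrite eG.
    case: ifP => // xD; by rewrite (disjointFr dG xD).
  rewrite negb_and => nn; apply/esym/eqP; rewrite prodf_seq_eq0; apply/hasP.
  case/orP: nn => [eG|/pred0Pn[x /= /andP[xD xG]]].
    by exists e; rewrite ?mem_enum // /phi eqxx (negbTE eG); apply/eqP.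
  exists x; first by rewrite mem_enum (fintype.subsetP DS).
  rewrite /phi xD xG; have [xe|_] := eqVneq x e; last by apply/eqP.
  by move: eD; rewrite -xe xD.
rewrite Ebern_prod ?enum_uniq //; last by move=> x _; rewrite inE.
rewrite big_enum (bigD1 e) //= /phi eqxx mulr1 mulr0 addr0; congr (_ * _).
rewrite -prodr_const [RHS]big_mkcond /= [LHS]big_mkcond /=; apply: eq_bigr => x _.
have [xD|xD] := boolP (x \in D).
  rewrite (fintype.subsetP DS) //=; case: eqP => [xe|_] /=.
    by move: eD; rewrite -xe xD.
  by rewrite mulr0 add0r mulr1.
by case: ifP => // /andP[_ /negbTE ->]; ring.
Qed.

(** The set [f] stays out of the cover if for no [v] is the edge [f + v]
    present and its rescuers all absent. For each [v] this event is decreasing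
    in the edges containing [f] and increasing in the other ones, because
    rescuers do not contain [f]; Harris' inequality therefore bounds the
    probability of the conjunction by the product, and no dependence between
    different [v] has to be analysed. *)
Lemma two_stage_cover_prob f : f \in F ->
  Ebern p S (fun G => (f \in two_stage_cover G)%:R) finset.set0 <=
  1 - \prod_(v | v \notin f) (1 - p * (1 - p) ^+ #|rescuers f v|).
Proof.
move=> fF.
pose b v (G : {set {set V}}) := ((v |: f)%SET \in G) && [disjoint rescuers f v & G].
pose h v G : R := (~~ b v G)%:R.
have hE v : v \notin f -> Ebern p S (h v) finset.set0 = 1 - p * (1 - p) ^+ #|rescuers f v|.
  move=> vf; rewrite -(Ebern_hit_avoid (v |: f)%SET).
  - rewrite -[X in X + _](Ebern_cst p S 1 finset.set0) -mulN1r -EbernZ -EbernD.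
    by apply: Ebern_ext => G _; rewrite /h /b; case: (_ && _) => /=; ring.
  - by rewrite inE cardsU1 vf (cardF f fF).
  - by apply/fintype.subsetP => e /(mem_rescuers f v e fF)[ce _ _]; rewrite inE ce.
  - by apply/negP => /(mem_rescuers f v _ fF)[_ /eqP].
rewrite -(eq_bigr _ hE) lerBrDr.
have harris := Ebern_harris_prod p p01 [set e : {set V} | f \subset e]%SET V
  (index_enum V) (fun v => v \notin f) h S finset.set0.
apply: le_trans (lerD (lexx _) (harris _ _)) _.
- by move=> v G; rewrite /h ler0n.
- move=> v vf e G; rewrite inE /h; case: ifP => fe.
    have eD : e \notin rescuers f v by apply/negP => /(mem_rescuers f v e fF)[_ _ /negP].
    apply: ler_bool; apply/implyP; apply: contra => /andP[vG dG].
    rewrite /b in_setU1 vG orbT /=; apply/fintype.pred0P => x /=.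
    rewrite in_setU1; apply/negP => /andP[xD /predU1P[xe|xG]].
      by move: eD; rewrite -xe xD.
    by rewrite (disjointFr dG xD) in xG.
  apply: ler_bool; apply/implyP; apply: contra => /andP[vG dG].
  rewrite /b; move: vG; rewrite in_setU1 => /predU1P[ev|->] /=.
    by move: fe; rewrite -ev finset.subsetUr.
  by apply: disjointWr dG; apply: finset.subsetUr.
rewrite -[X in _ <= X](Ebern_cst p S 1 finset.set0) -EbernD.
apply: Ebern_le => // G; have [fC|fC] := boolP (f \in two_stage_cover G); last first.
  rewrite add0r; apply: prodr_ile1 => v _; rewrite /h ler0n /=.
  by case: (~~ _).
have [v [vf vG dG]] := two_stage_cover_miss G f fC.
by rewrite (bigD1 v) //= /h /b vG dG /= mul0r addr0.
Qed.
End Prob.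
End Cover.

(** * The expected size of a two-stage cover *)

Section MissProbability.
Context {R : realType}.
Implicit Types (p x z : R).

(** [1 - p z] and [1 + t], with [t = p z / (1 - p)], have product at least 1,
    and [1 + t <= expR t]. *)
Lemma expR_le_factor p x z : 0 <= p <= 1 / 2 -> 0 <= x <= z -> z <= 1 ->
  expR (- (p / (1 - p) * z)) <= 1 - p * x.
Proof.
move=> /andP[p0 p12] /andP[x0 xz] z1.
have q0 : 0 < 1 - p by lra.
set t := p / (1 - p) * z.
have z0 : 0 <= z by lra.
have t0 : 0 <= t by rewrite /t !mulr_ge0 // invr_ge0 ltW.
apply: (@le_trans _ _ (1 - p * z)); last by have := ler_wpM2l p0 xz; lra.
rewrite expRN -[leLHS]mul1r ler_pdivrMr ?expR_gt0 //.
have pz : p * z <= p by apply: ler_piMr.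
apply: (@le_trans _ _ ((1 - p * z) * (1 + t))); last first.
  by apply: ler_wpM2l; [lra|exact: expR_ge1Dx].
have -> : (1 - p * z) * (1 + t) = 1 + t * (p * (1 - z)).
  by rewrite /t; field; rewrite gt_eqF.
rewrite lerDl; apply: mulr_ge0 t0 _; apply: mulr_ge0 p0 _; lra.
Qed.

Lemma expr1B_le_expR p m D : 0 <= p <= 1 -> D <= m%:R -> (1 - p) ^+ m <= expR (- (p * D)).
Proof.
move=> /andP[p0 p1] Dm; apply: (@le_trans _ _ (expR (- p) ^+ m)).
  by apply: lerXn2r; rewrite ?nnegrE ?expR_ge0 ?subr_ge0 //; exact: expR_ge1Dx.
by rewrite -expRM_natl ler_expR mulrN lerN2 (mulrC _ p) ler_wpM2l.
Qed.

Variables (V : finType).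

(** Here [r v] is the number of rescuers, [u] the set of primary extensions
    and [B] a set of exceptional vertices. A vertex in [u] or [B] costs a
    factor close to [expR (- p)], any other one only [expR (- p y)]. *)
Lemma miss_prob_ge (f : {set V}) (u : pred V) (B : {set V}) (r : V -> nat) p D :
  0 <= p <= 1 / 2 -> 0 <= D ->
  (forall v, v \notin f -> ~~ u v -> v \notin B -> D <= (r v)%:R) ->
  let y := expR (- (p * D)) in
  expR (- (p / (1 - p) * (y * #|V|%:R + (1 - y) * #|[set v | (v \notin f) && u v]%SET|%:R + #|B|%:R)))
   <= \prod_(v | v \notin f) (1 - p * (1 - p) ^+ r v).
Proof.
move=> p01 D0 rD /=; set y := expR (- (p * D)); have /andP[p0 p12] := p01.
have p1 : 0 <= p <= 1 by rewrite p0 /=; lra.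
have y0 : 0 <= y := expR_ge0 _.
have y1 : y <= 1 by rewrite /y expR_le1 oppr_le0 mulr_ge0.
(* the weight of v in the exponent *)
pose z v : R := if u v || (v \in B) then 1 else y.
have zP v : v \notin f -> expR (- (p / (1 - p) * z v)) <= 1 - p * (1 - p) ^+ r v.
  move=> vf; apply: expR_le_factor => //; last by rewrite /z; case: ifP.
  rewrite exprn_ge0 ?subr_ge0; last by case/andP: p1.
  rewrite /z; case: ifP => [_|].
    by rewrite exprn_ile1 //; lra.
  by move=> /negbT; rewrite negb_or => /andP[uv vB]; apply: expr1B_le_expR p1 _; exact: rD.
apply: (@le_trans _ _ (\prod_(v | v \notin f) expR (- (p / (1 - p) * z v)))); last first.
  by apply: ler_prod => v /zP ->; rewrite expR_ge0.
rewrite -expR_sum ler_expR sumrN -mulr_sumr lerN2 ler_wpM2l //.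
  by apply: divr_ge0 => //; lra.
apply: (@le_trans _ _ (\sum_(v | v \notin f) (y + (1 - y) * (u v)%:R + (v \in B)%:R))).
  apply: ler_sum => v _; rewrite /z; case: (u v); case: (v \in B); rewrite /=; lra.
rewrite big_mkcond /=.
apply: (@le_trans _ _ (\sum_v (y + (1 - y) * ((v \notin f) && u v)%:R + (v \in B)%:R))).
  apply: ler_sum => v _; case: (v \notin f) => //=.
  by case: (v \in B) => /=; lra.
rewrite !big_split /= -mulr_sumr sumr_const mulr_natr lerD // ?lerD //.
  rewrite ler_wpM2l ?subr_ge0 //.
  by rewrite -sum1dep_card natr_sum [leRHS]big_mkcond /=; apply: ler_sum => v _; case: (_ && _).
by rewrite -sum1_card natr_sum [leRHS]big_mkcond /=; apply: ler_sum => v _; case: (_ \in _).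
Qed.

End MissProbability.

Section Scheme.
Context {R : realType}.
Implicit Types (k n : nat).

(** A covering system [F] of density [pi] with primary extensions [U] such
    that, outside a small set [E] of members, a proportion [alpha] of the
    vertices are primary extensions and all but few of the other ones have
    at least about [kappa n] rescuers; [eta] is the tolerance in each
    clause. *)
Record scheme (k n : nat) (pi alpha kappa eta : R) (F : {set {set 'I_n}})
    (U : {set 'I_n} -> 'I_n -> bool) (E : {set {set 'I_n}}) : Prop := Scheme {
  scheme_sub : F \subset ksubsets 'I_n k;
  scheme_turan : forall e : {set 'I_n}, #|e| = k.+1 -> exists2 f, f \in F & f \subset e;
  scheme_density : #|F|%:R <= (pi + eta) * ('C(n, k))%:R;
  scheme_exc : #|E|%:R <= eta * ('C(n, k))%:R;
  scheme_primary : forall f, f \in F -> f \notin E ->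
    #|[set v | (v \notin f) && U f v]%SET|%:R <= (alpha + eta) * n%:R;
  scheme_secondary : forall f, f \in F -> f \notin E -> exists2 B : {set 'I_n},
    #|B|%:R <= eta * n%:R &
    forall v, v \notin f -> ~~ U f v -> v \notin B ->
      (kappa - eta) * n%:R <= #|rescuers 'I_n F U f v|%:R }.

Lemma Ebern_tau_le_cover k n (p : R) (F : {set {set 'I_n}}) U :
  0 <= p <= 1 -> F \subset ksubsets 'I_n k ->
  (forall e : {set 'I_n}, #|e| = k.+1 -> exists2 f, f \in F & f \subset e) ->
  Ebern p (enum (ksubsets 'I_n k.+1)) (fun G => (tau k G)%:R) finset.set0 <=
  \sum_(f in F) (1 - \prod_(v | v \notin f) (1 - p * (1 - p) ^+ #|rescuers 'I_n F U f v|)).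
Proof.
move=> p01 Fk turan.
apply: (@le_trans _ _ (Ebern p (enum (ksubsets 'I_n k.+1))
   (fun G => \sum_(f in F) (f \in two_stage_cover 'I_n F U G)%:R) finset.set0)); last first.
  by rewrite Ebern_sum; apply: ler_sum => f fF; exact: (two_stage_cover_prob 'I_n k).
apply: Ebern_le_in => // G GS.
have rG : is_rgraph k.+1 G.
  by apply/fintype.subsetP => e eG; apply: contraLR eG => eS; rewrite GS ?inE // mem_enum.
have [_ /(_ _ (two_stage_coverP _ _ F U Fk turan G rG)) tauC] := tauP (leqnSn k) rG.
apply: (@le_trans _ _ (#|two_stage_cover 'I_n F U G|%:R)); first by rewrite ler_nat.
rewrite -sum1_card natr_sum big_mkcond [leRHS]big_mkcond /=; apply: ler_sum => f _.
by rewrite inE; case: (f \in F) => //=; case: (_ || _).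
Qed.

Lemma scheme_Ebern_tau k n (p pi alpha kappa eta : R) F U E :
  0 <= p <= 1 / 2 -> 0 <= eta <= kappa -> 0 <= pi -> 0 <= alpha <= 1 ->
  scheme k n pi alpha kappa eta F U E ->
  Ebern p (enum (ksubsets 'I_n k.+1)) (fun G => (tau k G)%:R) finset.set0 <=
  ('C(n, k))%:R * (eta + (pi + eta) *
    (1 - expR (- (p / (1 - p) * n%:R * (alpha + (1 - alpha) * expR (- (p * ((kappa - eta) * n%:R))) + 2 * eta))))).
Proof.
move=> p12 /andP[e0 ek] pi0 /andP[a0 a1] [Fk turan cF cE prim sec].
have /andP[p0 p2] := p12; have p01 : 0 <= p <= 1 by rewrite p0 /=; lra.
apply: le_trans (Ebern_tau_le_cover k n p F U p01 Fk turan) _.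
set y := expR (- (p * _)); set X := p / _ * _ * _.
have y0 : 0 <= y := expR_ge0 _.
have D0 : 0 <= (kappa - eta) * n%:R by rewrite mulr_ge0 ?ler0n // subr_ge0.
have y1 : y <= 1 by rewrite /y expR_le1 oppr_le0 mulr_ge0 //; lra.
have n0 : 0 <= n%:R :> R by rewrite ler0n.
have c0 : 0 <= p / (1 - p) by apply: divr_ge0 => //; clear -p2; lra.
have X0 : 0 <= X.
  have /mulr_ge0/(_ y0) ay : 0 <= 1 - alpha by rewrite subr_ge0.
  by rewrite /X; apply: mulr_ge0 (mulr_ge0 c0 n0) _; lra.
have E1 : 0 <= 1 - expR (- X) by rewrite subr_ge0 expR_le1 oppr_le0.
have good f : f \in F -> f \notin E ->
  1 - \prod_(v | v \notin f) (1 - p * (1 - p) ^+ #|rescuers 'I_n F U f v|) <= 1 - expR (- X).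
  move=> fF fE; have [B cB hB] := sec f fF fE.
  rewrite lerB //; apply: le_trans (miss_prob_ge _ f (U f) B _ p _ p12 D0 hB).
  rewrite -/y ler_expR lerN2 /X -[leRHS]mulrA ler_wpM2l // card_ord.
  have := prim f fF fE => /(ler_wpM2l (x := 1 - y)); rewrite subr_ge0 => /(_ y1).
  have := mulr_ge0 (mulr_ge0 e0 n0) y0.
  move: (#|[set v | _]%SET|%:R) => a; clear -e0 y0 y1 cB; nra.
have bound f : f \in F ->
  1 - \prod_(v | v \notin f) (1 - p * (1 - p) ^+ #|rescuers 'I_n F U f v|) <=
  (f \in E)%:R + (1 - expR (- X)).
  move=> fF; have [fE|fE] := boolP (f \in E); last by rewrite add0r good.
  apply: (@le_trans _ _ 1); last by rewrite lerDl.
  rewrite lerBlDr lerDl; apply: prodr_ge0 => v _.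
  have [q0 q1] : 0 <= 1 - p /\ 1 - p <= 1 by split; clear -p0 p2; lra.
  by rewrite subr_ge0 mulr_ile1 ?exprn_ge0 ?exprn_ile1 //; case/andP: p01.
apply: le_trans (ler_sum _ bound) _.
rewrite big_split /= sumr_const mulrDr; apply: lerD.
  rewrite mulrC; apply: le_trans cE.
  rewrite -sum1_card natr_sum [leRHS]big_mkcond [leLHS]big_mkcond /=.
  by apply: ler_sum => f _; case: (f \in F); case: (f \in E).
by rewrite -[leLHS]mulr_natl mulrA [X in _ <= X * _]mulrC ler_wpM2r.
Qed.
End Scheme.

(** * Asymptotics of the expected size *)

Section Limit.
Context {R : realType}.

Lemma expR_le1D2 (x : R) : 0 <= x <= 1 / 2 -> expR x <= 1 + 2 * x.
Proof.
move=> /andP[x0 x1].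
have h : 1 - x <= expR (- x) := expR_ge1Dx (- x).
rewrite -[x]opprK expRN -div1r ler_pdivrMr ?expR_gt0 //.
have := ler_wpM2l (_ : 0 <= 1 + 2 * x) h; rewrite opprK => h2.
apply: le_trans (h2 _); nra.
Qed.

(** The effect of the tolerance [eta] on the cost of a scheme is [O(eta)],
    uniformly for [d] in [[0, C]]. *)
Lemma miss_exponent_error (p n k d C pi alpha kappa eta : R) :
  0 <= p <= 1 / 2 -> 0 <= n -> 0 <= k -> d = (n - k) * p -> 0 <= d <= C ->
  p / (1 - p) * n <= d * (1 + eta) ->
  0 <= alpha <= 1 -> 0 <= pi <= 1 -> 0 <= eta <= 1 -> eta <= kappa -> eta * C <= 1 / 2 ->
  eta + (pi + eta) *
    (1 - expR (- (p / (1 - p) * n * (alpha + (1 - alpha) * expR (- (p * ((kappa - eta) * n))) + 2 * eta))))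
  <= pi * (1 - expR (- (d * (alpha + (1 - alpha) * expR (- (kappa * d)))))) +
     eta * (2 + 2 * (C * (5 + 4 * C))).
Proof.
move=> /andP[p0 p2] n0 k0 dE /andP[d0 dC] pn /andP[a0 a1] /andP[pi0 pi1] /andP[e0 e1] ek eC.
have C0 : 0 <= C by lra.
set y := expR (- (p * _)).
set E0 := expR (- (kappa * d)).
have E00 : 0 <= E0 := expR_ge0 _.
have E01 : E0 <= 1 by rewrite /E0 expR_le1 oppr_le0 mulr_ge0 //; lra.
have eC0 : 0 <= eta * C by rewrite mulr_ge0.
have g1 : expR (eta * C) <= 1 + 2 * (eta * C) by apply: expR_le1D2; rewrite eC0.
have g0 : 1 <= expR (eta * C) by rewrite -expR0 ler_expR.
have yE : y <= E0 * expR (eta * C).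
  rewrite /y /E0 -expRD ler_expR.
  have kp : 0 <= k * p by rewrite mulr_ge0.
  have h1 : (kappa - eta) * d <= (kappa - eta) * (n * p).
    by rewrite ler_wpM2l ?subr_ge0 // dE; lra.
  have := ler_wpM2l e0 dC; lra.
set g := expR (eta * C) in g1 g0 yE.
set A := alpha + (1 - alpha) * E0.
have A1 : A <= 1.
  rewrite /A; have : (1 - alpha) * E0 <= (1 - alpha) by apply: ler_piMr => //; lra.
  lra.
have A0 : 0 <= A by rewrite /A addr_ge0 // mulr_ge0 // subr_ge0.
have yA : alpha + (1 - alpha) * y <= A * g.
  have h1 : (1 - alpha) * y <= (1 - alpha) * (E0 * g) by rewrite ler_wpM2l // subr_ge0.
  have h2 : alpha * 1 <= alpha * g by rewrite ler_wpM2l.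
  rewrite /A; lra.
have y0 : 0 <= y := expR_ge0 _.
set X := p / (1 - p) * n * _.
set delta := C * eta * (5 + 4 * C).
have delta0 : 0 <= delta by rewrite /delta; rewrite !mulr_ge0 //; lra.
have XA : X <= d * A + delta.
  have h0 : 0 <= alpha + (1 - alpha) * y + 2 * eta.
    have /mulr_ge0/(_ y0) : 0 <= 1 - alpha by rewrite subr_ge0.
    lra.
  apply: (@le_trans _ _ (d * (1 + eta) * (A * g + 2 * eta))).
    apply: (@le_trans _ _ (d * (1 + eta) * (alpha + (1 - alpha) * y + 2 * eta))).
      by rewrite ler_wpM2r.
    by rewrite ler_wpM2l ?mulr_ge0 ?addr_ge0 // lerD2r.
  have hA : (1 + eta) * (A * g + 2 * eta) <= A + eta * (5 + 4 * C).
    have h1 : A * ((1 + eta) * g - 1) <= (1 + eta) * g - 1.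
      apply: ler_piMl => //; rewrite subr_ge0.
      have : eta * 1 <= eta * g by rewrite ler_wpM2l.
      lra.
    have h2 : (1 + eta) * g <= (1 + eta) * (1 + 2 * (eta * C)) by rewrite ler_wpM2l // addr_ge0.
    have h3 : eta * eta <= eta by apply: ler_piMr.
    have h4 : eta * (eta * C) <= eta * C by apply: ler_piMl.
    lra.
  have h5 := ler_wpM2l d0 hA.
  have h6 : d * (eta * (5 + 4 * C)) <= C * (eta * (5 + 4 * C)).
    by rewrite ler_wpM2r // mulr_ge0 //; lra.
  rewrite /delta; lra.
have EX : 1 - expR (- X) <= 1 - expR (- (d * A)) + delta.
  have h1 : expR (- (d * A)) * expR (- delta) <= expR (- X).
    by rewrite -expRD ler_expR; lra.
  have h2 : expR (- (d * A)) * (1 - delta) <= expR (- (d * A)) * expR (- delta).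
    by rewrite ler_wpM2l ?expR_ge0 //; exact: expR_ge1Dx.
  have h3 : expR (- (d * A)) * delta <= delta.
    by apply: ler_piMl => //; rewrite expR_le1 oppr_le0 mulr_ge0.
  lra.
have Q0 : 0 < expR (- (d * A)) := expR_gt0 _.
move: (expR (- X)) (expR (- (d * A))) EX Q0 => ex q EX Q0.
have h1 : (pi + eta) * (1 - ex) <= (pi + eta) * (1 - q + delta) by rewrite ler_wpM2l // addr_ge0.
have h2 : eta * (1 - q) <= eta by apply: ler_piMr => //; lra.
have h3 : (pi + eta) * delta <= 2 * delta by rewrite ler_wpM2r //; lra.
have -> : eta * (2 + 2 * (C * (5 + 4 * C))) = 2 * eta + 2 * delta by rewrite /delta; ring.
lra.
Qed.

(** The expected cover has asymptotic density at most
    [pi (1 - exp (- d (alpha + (1 - alpha) exp (- kappa d))))]: each [f] has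
    about [alpha n] primary extensions, and each of the [(1 - alpha) n] other
    ones is without rescuers with probability about [exp (- kappa d)]. *)
Lemma scheme_limit k (p : nat -> R) (pi alpha kappa : R) :
  (forall n, 0 <= p n <= 1) -> Theta1 (mean_codeg k.+1 p) ->
  0 <= pi <= 1 -> 0 <= alpha <= 1 -> 0 < kappa ->
  (forall eta : R, 0 < eta -> \forall n \near \oo%classic,
     exists F U E, scheme k n pi alpha kappa eta F U E) ->
  forall e : R, 0 < e -> \forall n \near \oo%classic,
    Ebern (p n) (enum (ksubsets 'I_n k.+1)) (fun G => (tau k G)%:R) finset.set0 <=
    ('C(n, k))%:R * (pi * (1 - expR (- (mean_codeg k.+1 p n *
       (alpha + (1 - alpha) * expR (- (kappa * mean_codeg k.+1 p n)))))) + e).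
Proof.
move=> p01 [c [C [c0 C0 dC]]] pi01 a01 k0 sch e e0.
have K0 : 0 < kappa^-1 by rewrite invr_gt0.
pose M := 2 + 2 * (C * (5 + 4 * C)).
have M0 : 0 < M by have : 0 <= C * (5 + 4 * C) by [apply: mulr_ge0; lra]; rewrite /M; lra.
have Me0 : 0 < M / e by apply: divr_gt0.
(* 1 / S is below each of the four thresholds needed for eta *)
pose S := 1 + kappa^-1 + 2 * C + M / e.
have S0 : 0 < S by rewrite /S; lra.
pose eta := S^-1.
have eta0 : 0 < eta by rewrite invr_gt0.
have small x : x <= S -> eta * x <= 1 by move=> xS; rewrite /eta ler_pdivrMl // mulr1.
have eta1 : eta <= 1 by have := small 1; rewrite mulr1; apply; rewrite /S; lra.
have etaC : eta * C <= 1 / 2 by have := small (2 * C); rewrite /S; lra.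
have etak : eta <= kappa.
  have : eta / kappa <= 1 by apply: small; rewrite /S; lra.
  by rewrite ler_pdivrMr // mul1r.
have etaM : eta * M <= e.
  have : eta * (M / e) <= 1 by apply: small; rewrite /S; lra.
  by rewrite mulrA ler_pdivrMr // mul1r.
have large := nbhs_infty_ger (k%:R + 2 * C + 1 + (1 + eta) * (k%:R + C) / eta).
near=> n.
have /andP[_ dnC] : c <= mean_codeg k.+1 p n <= C by near: n.
have /andP[dn0 _] : c <= mean_codeg k.+1 p n <= C by near: n.
have [F [U [E sc]]] : exists F U E, scheme k n pi alpha kappa eta F U E.
  by near: n; exact: sch.
have nbig : k%:R + 2 * C + 1 + (1 + eta) * (k%:R + C) / eta <= n%:R by near: n.
have [pn0 pn1] : 0 <= p n /\ p n <= 1 by apply/andP.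
have kk0 : 0 <= k%:R :> R by rewrite ler0n.
have t0 : 0 <= (1 + eta) * (k%:R + C) / eta.
  by rewrite divr_ge0 ?mulr_ge0 ?addr_ge0 // ltW.
have dE : mean_codeg k.+1 p n = (n%:R - k%:R) * p n by [].
move: (mean_codeg k.+1 p n) dnC dn0 dE => d dnC dn0 dE.
have nk : 0 < n%:R - k%:R :> R by lra.
have pn2 : p n <= 1 / 2.
  have h : (n%:R - k%:R) * p n * 2 <= n%:R - k%:R by rewrite -dE; lra.
  by rewrite -(ler_pM2l nk); lra.
have pnd : p n / (1 - p n) * n%:R <= d * (1 + eta).
  have h : (1 + eta) * (k%:R + C) <= eta * n%:R.
    by rewrite -ler_pdivrMl // mulrC; lra.
  have h1 : n%:R <= (1 + eta) * (n%:R - k%:R - d).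
    have := ler_wpM2l (ltW eta0) dnC; lra.
  rewrite mulrAC ler_pdivrMr; last by lra.
  have := ler_wpM2l pn0 h1; rewrite dE; clear; lra.
have p12 : 0 <= p n <= 1 / 2 by rewrite pn0.
have eta01 : 0 <= eta <= 1 by rewrite ltW.
have d01 : 0 <= d <= C by rewrite dnC andbT; exact: le_trans (ltW c0) dn0.
have /andP[pi0 _] := pi01.
apply: le_trans (scheme_Ebern_tau k n (p n) pi alpha kappa eta F U E p12 _ pi0 a01 sc) _.
  by rewrite ltW.
apply: ler_wpM2l => //.
apply: le_trans (miss_exponent_error (p n) n%:R k%:R d C pi alpha kappa eta p12 _ kk0 dE d01 pnd a01 pi01 eta01 etak etaC) _ => //.
by rewrite lerD2l.
Unshelve. all: by end_near. Qed.
End Limit.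

(** * Concentration of the cover number *)

Section Concentration.
Context {R : realType}.
Local Notation E n k p f := (Ebern p (enum (ksubsets 'I_n k.+1)) f finset.set0).

Lemma bin_geB n k : (0 < k)%N -> (n <= 'C(n, k) + k)%N.
Proof.
case: k => // k _; elim: n => [//|n IH]; rewrite binS.
have [kn|nk] := leqP k n; last by apply: leq_trans (leqW nk) (leq_addl _ _).
have : (0 < 'C(n, k))%N by rewrite bin_gt0.
lia.
Qed.

Lemma Hr_pr_le1 n r (p : R) (P : {set {set 'I_n}} -> bool) : 0 <= p <= 1 -> Hr_pr r p P <= 1.
Proof.
move=> p01; rewrite Hr_prE -[leRHS](Ebern_cst p (enum (ksubsets 'I_n r)) 1 finset.set0).
by apply: Ebern_le => // G; rewrite lern1 leq_b1.
Qed.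

(** The variance of the cover number is at most [p] times the number of
    [k.+1]-sets, hence at most [(n - k) p] times ['C(n, k)]. *)
Lemma Hr_pr_tau_ge n k (p t x : R) : 0 <= p <= 1 -> (k <= n)%N -> 0 < t ->
  E n k p (fun G => (tau k G)%:R) + t <= x ->
  1 - (n%:R - k%:R) * p * ('C(n, k))%:R / t ^+ 2 <=
  Hr_pr k.+1 p (fun G : {set {set 'I_n}} => (tau k G)%:R <= x).
Proof.
move=> p01 kn t0 Tx; rewrite Hr_prE.
set S := ksubsets 'I_n k.+1.
pose f (G : {set {set 'I_n}}) : R := (tau k (G :&: S)%SET)%:R.
have inS (H : {set {set 'I_n}}) : (forall x, x \notin enum S -> (x \in H) = (x \in (finset.set0 : {set {set 'I_n}}))) ->
   (H :&: S)%SET = H.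
  move=> HS; apply/setP => e; rewrite finset.in_setI; have [eS|eS] := boolP (e \in S).
    by rewrite andbT.
  by rewrite andbF HS ?mem_enum // inE.
have TE : E n k p (fun G => (tau k G)%:R) = Ebern p (enum S) f finset.set0.
  by apply: Ebern_ext => H HS; rewrite /f inS.
have lip (H : {set {set 'I_n}}) e : `|f (e |: H)%SET - f H| <= 1.
  rewrite /f; have [h1 h2] := tau_lipschitz 'I_n k H e.
  by rewrite ger0_norm ?subr_ge0 ?ler_nat // lerBlDr nat1r ler_nat.
have var := Ebern_var p p01 (enum S) f finset.set0 lip.
have cheb := Ebern_chebyshev p p01 (enum S) f finset.set0 _ t t0 var.
have cS : (k.+1 * #|S| = (n - k) * 'C(n, k))%N.
  have -> : S = [set A in powerset [set: 'I_n] | #|A| == k.+1]%SET.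
    by apply/setP => A; rewrite !inE finset.subsetT.
  by rewrite (eq_card (B := [set A : {set 'I_n} | A \subset [set: 'I_n] & #|A| == k.+1]%SET)) ?cards_draws ?cardsT ?card_ord ?mul_bin_left // => A; rewrite !inE.
have V : (size (enum S))%:R * p <= (n%:R - k%:R) * p * ('C(n, k))%:R.
  rewrite -cardE mulrAC; apply: ler_wpM2r; first by case/andP: p01.
  by rewrite -natrB // -natrM -cS ler_nat leq_pmull.
rewrite lerBlDr; apply: (@le_trans _ _ (Ebern p (enum S) (fun G => ((tau k G)%:R <= x)%R%:R) finset.set0 +
  Ebern p (enum S) (fun H => (Ebern p (enum S) f finset.set0 + t < f H)%R%:R) finset.set0)); last first.
  rewrite lerD2l; apply: le_trans cheb _.
  by rewrite ler_pM2r // invr_gt0 exprn_gt0.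
rewrite -EbernD -[leLHS](Ebern_cst p (enum S) 1 finset.set0).
apply: Ebern_le_in => // H HS; rewrite /f (inS H HS) -TE.
case: (leP (tau k H)%:R x) => h; first by rewrite lerDl ler0n.
by rewrite (le_lt_trans Tx h) /= add0r.
Qed.

(** An asymptotic bound on the mean is enough, because the standard deviation
    is at most of order [sqrt 'C(n, k)]. *)
Lemma tau_whp k (p b : nat -> R) (b0 : R) : (0 < k)%N ->
  (forall n, 0 <= p n <= 1) -> Theta1 (mean_codeg k.+1 p) -> 0 < b0 ->
  (\forall n \near \oo%classic, b0 <= b n) ->
  (forall e : R, 0 < e -> \forall n \near \oo%classic,
     E n k (p n) (fun G => (tau k G)%:R) <= ('C(n, k))%:R * (b n + e)) ->
  exists eps : nat -> R,
    (eps n @[n --> \oo%classic] --> (0 : R))%classic /\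
    (Hr_pr k.+1 (p n) (fun G : {set {set 'I_n}} =>
       (tau k G)%:R <= (1 + eps n) * b n * ('C(n, k))%:R)
      @[n --> \oo%classic] --> (1 : R))%classic.
Proof.
move=> k0 p01 [c [C [c0 C0 dC]]] b00 bb0 ET.
pose N n : R := ('C(n, k))%:R.
pose s n : R := (Num.sqrt (Num.sqrt (N n)))^-1.
pose T n : R := E n k (p n) (fun G => (tau k G)%:R).
pose excess n : R := Num.max 0 (T n / (b n * N n) - 1).
have Nge n : n%:R - k%:R <= N n by rewrite lerBlDr -natrD ler_nat bin_geB.
have s0 : (s n @[n --> \oo%classic] --> (0 : R))%classic.
  apply/cvgr0Pnorm_le => e e0; have large := nbhs_infty_ger (k%:R + e^-1 ^+ 4 + 1).
  near=> n; have nbig : k%:R + e^-1 ^+ 4 + 1 <= n%:R by near: n.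
  have ei : 0 < e^-1 by rewrite invr_gt0.
  have h : e^-1 ^+ 4 <= N n by have := Nge n; lra.
  have h2 : e^-1 <= Num.sqrt (Num.sqrt (N n)).
    have := ler_wsqrtr (ler_wsqrtr h).
    rewrite (_ : e^-1 ^+ 4 = (e^-1 ^+ 2) ^+ 2); last by rewrite -exprM.
    have e2 : 0 <= e^-1 ^+ 2 by rewrite exprn_ge0 // ltW.
    by rewrite sqrtr_sqr (ger0_norm e2) sqrtr_sqr (ger0_norm (ltW ei)).
  rewrite ger0_norm ?invr_ge0 ?sqrtr_ge0 // /s.
  by rewrite -[leRHS]invrK lef_pV2 // posrE; apply: lt_le_trans h2.
have x0 : (excess n @[n --> \oo%classic] --> (0 : R))%classic.
  apply/cvgr0Pnorm_le => e e0; have large := nbhs_infty_ger (k%:R + 1 : R).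
  have ETe := ET (e * b0) (mulr_gt0 e0 b00).
  near=> n.
  have bn : b0 <= b n by near: n.
  have h : T n <= N n * (b n + e * b0) by near: n.
  have nbig : k%:R + 1 <= n%:R :> R by near: n.
  have N0 : 0 < N n by have := Nge n; lra.
  have bN : 0 < b n * N n by apply: mulr_gt0 => //; apply: lt_le_trans bn.
  rewrite ger0_norm ?le_max ?lexx // ge_max (ltW e0) /= lerBlDr ler_pdivrMr //.
  apply: le_trans h _; have := ler_wpM2l (ltW (mulr_gt0 e0 N0)) bn; lra.
(* excess n absorbs the error in the mean, and s n, which is 'C(n, k) to the
   power -1/4, leaves room for a deviation of much more than the standard one *)
exists (fun n => excess n + s n); split.
  by rewrite -[X in (_ --> X)%classic]addr0; exact: cvgD.
pose K := C / b0 ^+ 2.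
have lim1 : (1 - K * (s n * s n) @[n --> \oo%classic] --> (1 : R))%classic.
  rewrite -[X in (_ --> X)%classic]subr0 -[X in _ - X](mulr0 K) -[X in K * X](mulr0 0).
  by apply: cvgB; [exact: cvg_cst|apply: cvgMr; exact: cvgM].
have cst1 : ((1 : R) @[n --> \oo%classic] --> (1 : R))%classic by exact: cvg_cst.
apply: squeeze_cvgr lim1 cst1.
have large := nbhs_infty_ger (k%:R + 1 : R).
near=> n; apply/andP; split; last exact: Hr_pr_le1.
have bn : b0 <= b n by near: n.
have nbig : k%:R + 1 <= n%:R :> R by near: n.
have /andP[_ dnC] : c <= mean_codeg k.+1 p n <= C by near: n.
have kn : (k <= n)%N by rewrite -(ler_nat R); lra.
have N0 : 0 < N n by have := Nge n; lra.
have bpos : 0 < b n by apply: lt_le_trans bn.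
have bN : 0 < b n * N n by apply: mulr_gt0.
have ss : s n * s n = (Num.sqrt (N n))^-1.
  by rewrite /s -invfM -expr2 sqr_sqrtr // sqrtr_ge0.
have sq0 : 0 < Num.sqrt (N n) by rewrite sqrtr_gt0.
have sn0 : 0 < s n by rewrite invr_gt0 sqrtr_gt0.
have t0 : 0 < s n * (b n * N n) by apply: mulr_gt0.
apply: le_trans (Hr_pr_tau_ge n k (p n) (s n * (b n * N n)) _ (p01 n) kn t0 _); last first.
  rewrite -/(T n) -mulrA -/(N n) !mulrDl mul1r addrA lerD2r.
  have : T n / (b n * N n) - 1 <= excess n by rewrite le_max lexx orbT.
  move=> /(ler_wpM2r (ltW bN)); rewrite mulrBl mul1r divfK ?gt_eqF //.
  by rewrite lerBlDl.
rewrite lerD2l lerN2 -/(N n).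
have -> : (s n * (b n * N n)) ^+ 2 = b n ^+ 2 * (N n * Num.sqrt (N n)).
  have NE : N n = Num.sqrt (N n) ^+ 2 by rewrite sqr_sqrtr // ltW.
  move: (N n) (Num.sqrt (N n)) (s n) ss NE sq0 => m q a aa -> q0.
  transitivity (a * a * (b n * q ^+ 2) ^+ 2); first by ring.
  by rewrite aa; field; rewrite gt_eqF.
rewrite ss /K ler_pdivrMr; last by rewrite !mulr_gt0 // exprn_gt0.
apply: (@le_trans _ _ (C * N n)); first by rewrite ler_wpM2r // ltW.
have -> : C / b0 ^+ 2 * (Num.sqrt (N n))^-1 * (b n ^+ 2 * (N n * Num.sqrt (N n))) =
   C * N n * (b n ^+ 2 / b0 ^+ 2) by field; rewrite !gt_eqF.
apply: ler_peMr; first by rewrite mulr_ge0 // ltW.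
by rewrite ler_pdivlMr ?exprn_gt0 // mul1r lerXn2r ?nnegrE // ltW.
Unshelve. all: by end_near. Qed.

End Concentration.

(** * Systems given by vertex types *)

Section Types.
Context {R : realType}.

(** The assignment of residues gives every class its fair share up to
    one. *)
Lemma count_residue n m j : (j < m)%N ->
  (\sum_(i < n) (i %% m == j) = (n + (m - j.+1)) %/ m)%N.
Proof.
move=> jm; have m0 : (0 < m)%N by apply: leq_ltn_trans jm.
elim: n => [|n IH]; first by rewrite big_ord0 add0n divn_small // ltn_subrL m0.
rewrite big_ord_recr /= IH addSn divnS // addnC; congr (_ + _)%N.
have -> : ((n + (m - j.+1)).+1 = n + (m - j))%N by lia.
congr nat_of_bool; apply/eqP/idP => [<-|].
  by rewrite {1}(divn_eq n m) -addnA subnKC ?dvdn_add ?dvdn_mull // ltnW ?ltn_pmod.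
move=> h; have := modn_small jm => <-; apply/eqP.
rewrite -(eqn_modDr (m - j)) subnKC 1?ltnW // modnn; exact: h.
Qed.

Definition equitable (T : finType) n (sigma : 'I_n -> T) : Prop := forall t : T,
  (n%:R / #|T|%:R - 1 <= #|[set v | sigma v == t]%SET|%:R :> R) /\
  (#|[set v | sigma v == t]%SET|%:R <= n%:R / #|T|%:R + 1 :> R).

Lemma equitable_exists (T : finType) (t0 : T) n : exists sigma : 'I_n -> T, equitable T n sigma.
Proof.
have m0 : (0 < #|T|)%N by apply/card_gt0P; exists t0.
exists (fun v : 'I_n => enum_val (Ordinal (ltn_pmod v m0))) => t.
have -> : #|[set v : 'I_n | enum_val (Ordinal (ltn_pmod v m0)) == t]%SET| =
   ((n + (#|T| - (enum_rank t).+1)) %/ #|T|)%N.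
  rewrite -count_residue // -sum1dep_card [LHS]big_mkcond /=; apply: eq_bigr => v _.
  rewrite -(inj_eq enum_rank_inj) enum_valK -val_eqE /=; by case: (_ == _).
move: (enum_rank t) => [j jm] /=; set x := (_ + _)%N; set q := (x %/ _)%N.
have h1 : (q * #|T| <= n + #|T|)%N by apply: leq_trans (leq_trunc_div _ _) _; rewrite leq_add2l leq_subr.
have h2 : (n <= q * #|T| + #|T|)%N.
  have := ltn_ceil x m0; rewrite -/q mulSn => h; rewrite addnC; apply: leq_trans (ltnW h).
  by rewrite leq_addr.
have m0R : 0 < #|T|%:R :> R by rewrite ltr0n.
split.
  rewrite lerBlDr ler_pdivrMr // mulrDl mul1r -natrM -natrD ler_nat //.
rewrite -lerBlDr ler_pdivlMr // mulrBl mul1r lerBlDr -natrM -natrD ler_nat //.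
Qed.

Lemma equitable_preimset (T : finType) n (sigma : 'I_n -> T) (A : {set T}) : equitable T n sigma ->
  (#|A|%:R * (n%:R / #|T|%:R - 1) <= #|[set v | sigma v \in A]%SET|%:R :> R) /\
  (#|[set v | sigma v \in A]%SET|%:R <= #|A|%:R * (n%:R / #|T|%:R + 1) :> R).
Proof.
move=> eqs; have -> : #|[set v | sigma v \in A]%SET| = (\sum_(t in A) #|[set v | sigma v == t]%SET|)%N.
  rewrite -sum1dep_card (partition_big sigma (mem A)) //=; apply: eq_bigr => t tA.
  rewrite -sum1dep_card; apply: eq_bigl => v.
  by case: eqP => [->|]; rewrite ?tA ?andbF.
have cst (x : R) : #|A|%:R * x = \sum_(t in A) x by rewrite mulr_natl sumr_const.
by rewrite natr_sum !cst; split; apply: ler_sum => t _; case: (eqs t).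
Qed.

Lemma factorial_mul_card_le n k (F : {set {set 'I_n}}) : F \subset ksubsets 'I_n k ->
  (k`! * #|F| <= #|[set t : {ffun 'I_k -> 'I_n} | injectiveb t & (t @: [set: 'I_k]) \in F]%SET|)%N.
Proof.
move=> Fk.
have cf f : f \in F -> k`! = #|[set t : {ffun 'I_k -> 'I_n} in ffun_on (mem f) | injectiveb t]%SET|.
  move=> /(fintype.subsetP Fk); rewrite inE => /eqP fk.
  by rewrite card_inj_ffuns_on card_ord fk ffactnn.
rewrite mulnC -sum_nat_const.
rewrite (eq_bigr _ cf) -sum1_card.
rewrite (partition_big (fun t : {ffun 'I_k -> 'I_n} => (t @: [set: 'I_k])%SET) (mem F)) /=; last first.
  by move=> t; rewrite inE => /andP[].
apply: leq_sum => f fF; rewrite sum1dep_card; apply: subset_leq_card.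
apply/fintype.subsetP => t; rewrite !inE => /andP[tf ti].
have im : (t @: [set: 'I_k])%SET = f.
  apply/eqP; rewrite eqEcard; apply/andP; split.
    by apply/fintype.subsetP => _ /imsetP[i _ ->]; move/ffun_onP: tf; apply.
  have := fintype.subsetP Fk f fF; rewrite inE => /eqP ->.
  by rewrite card_imset ?cardsT ?card_ord //; apply/injectiveP.
by rewrite ti im fF eqxx.
Qed.

(** Each member of [F] has [k!] orderings, and an ordering is determined by
    its sequence of types, which lies in [phi], and a choice of a vertex of
    the right type in each place. *)
Lemma type_count (T : finType) n k (sigma : 'I_n -> T) (F : {set {set 'I_n}}) (phi : {set {ffun 'I_k -> T}}) :
  equitable T n sigma -> F \subset ksubsets 'I_n k ->
  (forall t : {ffun 'I_k -> 'I_n}, injective t -> (t @: [set: 'I_k])%SET \in F ->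
     [ffun i => sigma (t i)] \in phi) ->
  (k`!)%:R * #|F|%:R <= #|phi|%:R * (n%:R / #|T|%:R + 1) ^+ k :> R.
Proof.
move=> eqs Fk Fphi.
rewrite -natrM; apply: le_trans (_ : #|[set t : {ffun 'I_k -> 'I_n} | [ffun i => sigma (t i)] \in phi]%SET|%:R <= _).
  rewrite ler_nat; apply: leq_trans (factorial_mul_card_le n k F Fk) _.
  apply: subset_leq_card; apply/fintype.subsetP => t; rewrite !inE => /andP[/injectiveP ti tF].
  exact: Fphi.
rewrite -sum1dep_card (partition_big (fun t : {ffun 'I_k -> 'I_n} => [ffun i => sigma (t i)]) (mem phi)) //=.
have cst (x : R) : #|phi|%:R * x = \sum_(t in phi) x by rewrite mulr_natl sumr_const.
rewrite natr_sum cst; apply: ler_sum => tau tphi.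
have -> : (\sum_(t : {ffun 'I_k -> 'I_n} | ([ffun i => sigma (t i)] \in phi) && ([ffun i => sigma (t i)] == tau)) 1)%:R
   = \sum_(t : {ffun 'I_k -> 'I_n}) \prod_(i < k) (sigma (t i) == tau i)%:R :> R.
  rewrite natr_sum big_mkcond /=; apply: eq_bigr => t _.
  have [/eqP e|ne] := boolP ([ffun i => sigma (t i)] == tau).
    rewrite e tphi /= big1 // => i _; by rewrite -e ffunE eqxx.
  rewrite andbF; apply/esym/eqP; rewrite prodf_seq_eq0; apply/hasP.
  have [i hi] : exists i, sigma (t i) != tau i.
    apply/existsP; apply: contraR ne => /existsPn h; apply/eqP/ffunP => i.
    by rewrite ffunE; apply/eqP; have := h i; rewrite negbK.
  by exists i; rewrite ?mem_index_enum //= (negbTE hi).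
rewrite -(bigA_distr_bigA (fun i v => (sigma v == tau i)%:R)) /=.
rewrite -[k in _ ^+ k]card_ord -prodr_const; apply: ler_prod => i _.
have -> : \sum_v (sigma v == tau i)%:R = #|[set v | sigma v == tau i]%SET|%:R :> R.
  by rewrite -sum1dep_card natr_sum [RHS]big_mkcond /=; apply: eq_bigr => v _; case: (_ == _).
by rewrite ler0n; case: (eqs (tau i)).
Qed.

(** Both sides are asymptotic to the [k]-th power of [n]; the shift by [a] makes
    room for types that are balanced only up to one vertex. *)
Lemma ffact_ge k a (e : R) : 0 < e ->
  \forall n \near \oo%classic, ((n + a)%N%:R) ^+ k <= (1 + e) * (n ^_ k)%:R :> R.
Proof.
elim: k e => [|k IH] e e0.
  by near=> n; rewrite expr0 ffactn0 mulr1; lra.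
pose d := Num.min 1 (e / 3).
have d0 : 0 < d by rewrite lt_min ltr01 /= divr_gt0.
have d1 : d <= 1 by rewrite ge_min lexx.
have d3 : d <= e / 3 by rewrite ge_min lexx orbT.
have IHd := IH d d0.
have large := nbhs_infty_ger (k%:R + ((1 + d) * (k + a)%:R) / d).
near=> n.
have h1 : ((n + a)%N%:R) ^+ k <= (1 + d) * (n ^_ k)%:R :> R by near: n.
have h2 : k%:R + (1 + d) * (k + a)%:R / d <= n%:R by near: n.
have ka : 0 <= (k + a)%:R :> R by [].
have kn : (k <= n)%N.
  by rewrite -(ler_nat R); apply: le_trans h2; rewrite lerDl divr_ge0 ?mulr_ge0 //; lra.
have h3 : (n + a)%:R <= (1 + d) * (n - k)%:R :> R.
  have : (1 + d) * (k + a)%:R <= d * n%:R.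
    by rewrite -ler_pdivrMl // mulrC; apply: le_trans h2; rewrite lerDr.
  rewrite natrB // !natrD; have : 0 <= a%:R :> R by []. nra.
rewrite exprSr ffactnSr natrM.
apply: le_trans (ler_pM _ _ h1 h3) _; rewrite ?exprn_ge0 //.
have -> : (1 + d) * (n ^_ k)%:R * ((1 + d) * (n - k)%:R) = (1 + d) ^+ 2 * ((n ^_ k)%:R * (n - k)%:R) by ring.
apply: ler_wpM2r; first by rewrite mulr_ge0.
have : d * d <= d by apply: ler_piMr => //; exact: ltW.
lra.
Unshelve. all: by end_near. Qed.

(** The data of a scheme read off from a colouring [sigma] of the vertices by
    finitely many types. The primary extensions of [f] are given by [a] types;
    when [v] is not primary and avoids at most [beta] bad types, at least [l]
    other members of [F] lie in [f + v]. The sets [phi] and [psi] contain the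
    possible sequences of types of the ordinary and exceptional members of
    [F], and so control their number. *)
Record typed_system (T : finType) n (sigma : 'I_n -> T) (k a l beta : nat)
    (phi psi : {set {ffun 'I_k -> T}}) (F : {set {set 'I_n}})
    (U : {set 'I_n} -> 'I_n -> bool) (E : {set {set 'I_n}}) : Prop := TypedSystem {
  typed_sub : F \subset ksubsets 'I_n k;
  typed_turan : forall e : {set 'I_n}, #|e| = k.+1 -> exists2 f, f \in F & f \subset e;
  typed_exc : E \subset F;
  typed_phi : forall t : {ffun 'I_k -> 'I_n}, injective t -> (t @: [set: 'I_k])%SET \in F ->
    (t @: [set: 'I_k])%SET \notin E -> [ffun i => sigma (t i)] \in phi;
  typed_psi : forall t : {ffun 'I_k -> 'I_n}, injective t -> (t @: [set: 'I_k])%SET \in E ->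
    [ffun i => sigma (t i)] \in psi;
  typed_primary : forall f, f \in F -> f \notin E -> exists A : {set T},
    #|A| = a /\ forall w, U f w = (sigma w \in A);
  typed_secondary : forall f, f \in F -> f \notin E -> exists B : {set T},
    (#|B| <= beta)%N /\ forall v, v \notin f -> ~~ U f v -> sigma v \notin B ->
    exists A : {set {set 'I_n}}, (l <= #|A|)%N /\
      forall g, g \in A -> [/\ g \in F, g \notin E, g \subset (v |: f)%SET & g != f] }.

(** Each of the [l] other members of [F] inside [f + v] has about
    [a n / #|T|] primary extensions, whence the value of [kappa]. *)
Lemma typed_system_scheme (T : finType) (k a l beta : nat) (phi psi : {set {ffun 'I_k -> T}})
  (pi eta : R) : (0 < #|T|)%N -> 0 < eta -> 0 <= pi <= 1 ->
  #|phi|%:R <= pi * #|T|%:R ^+ k -> #|psi|%:R <= eta / 8 * #|T|%:R ^+ k ->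
  beta%:R <= eta / 2 * #|T|%:R :> R ->
  \forall n \near \oo%classic, forall (sigma : 'I_n -> T) F U E, equitable T n sigma ->
    typed_system T n sigma k a l beta phi psi F U E ->
    scheme k n pi (a%:R / #|T|%:R) ((l * a)%:R / #|T|%:R) eta F U E.
Proof.
move=> T0 e0 /andP[pi0 pi1] cphi cpsi cbeta.
set m : R := #|T|%:R.
have m0 : 0 < m by rewrite ltr0n.
pose e1 := Num.min 1 (eta / 2).
have e10 : 0 < e1 by rewrite lt_min ltr01 /= divr_gt0.
have e11 : e1 <= 1 by rewrite ge_min lexx.
have e12 : e1 <= eta / 2 by rewrite ge_min lexx orbT.
have ff := ffact_ge k #|T| e1 e10.
have large := nbhs_infty_ger ((a%:R + 2 * beta%:R + l%:R * (a%:R + k.+1%:R)) / eta).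
near=> n => sigma F U E eqs [Fk turan EF tphi tpsi prim sec].
have hff : ((n + #|T|)%N%:R) ^+ k <= (1 + e1) * (n ^_ k)%:R :> R by near: n.
have nbig : (a%:R + 2 * beta%:R + l%:R * (a%:R + k.+1%:R)) / eta <= n%:R by near: n.
rewrite ler_pdivrMr // in nbig.
have kf0 : 0 < (k`!)%:R :> R by rewrite ltr0n fact_gt0.
have pw : (n%:R / m + 1) ^+ k * m ^+ k <= (1 + e1) * ((k`!)%:R * ('C(n, k))%:R).
  rewrite -exprMn mulrDl mul1r divfK ?gt_eqF // -natrD -natrM mulnC bin_ffact; exact: hff.
have pw0 : 0 <= (n%:R / m + 1) ^+ k :> R by rewrite exprn_ge0 // addr_ge0 // divr_ge0 // ltW.
have N0 : 0 <= ('C(n, k))%:R :> R by [].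
have cE : #|E|%:R <= eta / 4 * ('C(n, k))%:R.
  rewrite -(ler_pM2l kf0).
  have Ek : E \subset ksubsets 'I_n k := fintype.subset_trans EF Fk.
  apply: le_trans (type_count T n k sigma E psi eqs Ek tpsi) _.
  apply: le_trans (ler_wpM2r pw0 cpsi) _.
  have e8 : 0 <= eta / 8 by rewrite divr_ge0 // ltW.
  have := ler_wpM2l e8 pw.
  have : (1 + e1) * (k`!%:R * 'C(n, k)%:R) <= 2 * (k`!%:R * 'C(n, k)%:R).
    by rewrite ler_wpM2r ?mulr_ge0 //; lra.
  move=> /(ler_wpM2l e8).
  rewrite -/m; lra.
have cFE : #|F :\: E|%:R <= (pi + eta / 2) * ('C(n, k))%:R.
  rewrite -(ler_pM2l kf0).
  have FEk : F :\: E \subset ksubsets 'I_n k := fintype.subset_trans (finset.subsetDl _ _) Fk.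
  have hp : forall t : {ffun 'I_k -> 'I_n}, injective t -> (t @: [set: 'I_k])%SET \in F :\: E ->
     [ffun i => sigma (t i)] \in phi.
    by move=> t ti; rewrite finset.in_setD => /andP[tE tF]; exact: tphi.
  apply: le_trans (type_count T n k sigma _ phi eqs FEk hp) _.
  apply: le_trans (ler_wpM2r pw0 cphi) _.
  have := ler_wpM2l pi0 pw.
  have : pi * e1 <= eta / 2 by apply: le_trans e12; apply: ler_piMl => //; exact: ltW.
  move=> /(ler_wpM2r (mulr_ge0 (ltW kf0) N0)).
  rewrite -/m; lra.
have [a0 b0] : 0 <= a%:R :> R /\ 0 <= beta%:R :> R by split.
have lk0 : 0 <= l%:R * (a%:R + k.+1%:R) :> R by rewrite mulr_ge0 // addr_ge0.
have an : a%:R <= eta * n%:R by clear -nbig b0 lk0; lra.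
have bn : beta%:R <= eta / 2 * n%:R by clear -nbig a0 lk0; lra.
have ln : l%:R * (a%:R + k.+1%:R) <= eta * n%:R by clear -nbig a0 b0; lra.
split => //.
- apply: le_trans (_ : (#|F :\: E| + #|E|)%:R <= _).
    by rewrite ler_nat -(cardsID E F) addnC leq_add2l subset_leq_card // finset.subsetIr.
  by rewrite natrD; have := mulr_ge0 (ltW e0) N0; clear -cE cFE; lra.
- by have := mulr_ge0 (ltW e0) N0; clear -cE; lra.
- move=> f fF fE; have [A [cA UA]] := prim f fF fE.
  have [_ h] := equitable_preimset T n sigma A eqs.
  apply: le_trans (_ : #|[set v | sigma v \in A]%SET|%:R <= _).
    rewrite ler_nat; apply: subset_leq_card; apply/fintype.subsetP => v.
    by rewrite !inE UA => /andP[].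
  apply: le_trans h _; rewrite cA -/m; clear -an; lra.
- move=> f fF fE; have [B [cB hB]] := sec f fF fE.
  exists [set v | sigma v \in B]%SET.
    have [_ h] := equitable_preimset T n sigma B eqs.
    apply: le_trans h _; rewrite -/m.
    apply: (@le_trans _ _ (beta%:R * (n%:R / m + 1))).
      by rewrite ler_wpM2r ?ler_nat // addr_ge0 // divr_ge0 // ltW.
    have : beta%:R / m * n%:R <= eta / 2 * n%:R.
      by rewrite ler_wpM2r // ler_pdivrMr.
    clear -bn; lra.
  move=> v vf nU; rewrite inE => vB; have [AA [lAA hA]] := hB v vf nU vB.
  have [lo|lo] := leP ((l * a)%:R / m * n%:R - l%:R * (a%:R + k.+1%:R)) 0.
    apply: (@le_trans _ _ 0) => //; rewrite mulrBl subr_le0; apply: le_trans ln.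
    by rewrite -subr_le0.
  pose x : R := a%:R * (n%:R / m - 1) - k.+1%:R.
  have lx : l%:R * x = (l * a)%:R / m * n%:R - l%:R * (a%:R + k.+1%:R).
    by rewrite /x natrM; ring.
  have vfk : #|(v |: f)%SET| = k.+1.
    by rewrite cardsU1 vf; have := fintype.subsetP Fk f fF; rewrite inE => /eqP ->.
  have bound g : g \in AA -> x <= #|[set w | (w \notin (v |: f)%SET) && U g w]%SET|%:R.
    move=> /hA[gF gE _ _]; have [A [cA UA]] := prim g gF gE.
    have [h _] := equitable_preimset T n sigma A eqs.
    rewrite /x lerBlDr -natrD -cA; apply: le_trans h _; rewrite ler_nat.
    rewrite -vfk -(cardsID (v |: f)%SET [set v0 | sigma v0 \in A]%SET) addnC leq_add //.
      apply: subset_leq_card; apply/fintype.subsetP => w.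
      by rewrite !inE UA.
    by apply: subset_leq_card; exact: finset.subsetIr.
  have sub g : g \in AA -> [/\ g \in F, g \subset (v |: f)%SET & g != f].
    by move=> /hA[].
  have := rescuers_ge 'I_n F U f v AA nU sub; rewrite -(ler_nat R) natr_sum; apply: le_trans.
  apply: (@le_trans _ _ (\sum_(g in AA) x)); last by apply: ler_sum => g /bound.
  have x0 : 0 <= x.
    have l0 : 0 < l%:R * x by rewrite lx.
    by rewrite leNgt; apply/negP => xn; have := lt_le_trans l0 (mulr_ge0_le0 (ler0n R l) (ltW xn)); rewrite ltxx.
  have -> : \sum_(g in AA) x = #|AA|%:R * x by rewrite mulr_natl sumr_const.
  apply: (@le_trans _ _ (l%:R * x)); last by rewrite ler_wpM2r // ler_nat.
  by rewrite lx mulrBl lerD2l lerN2.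
Unshelve. all: by end_near. Qed.
End Types.

(** * Two and three classes *)

Lemma intermediate_subset (V : finType) (A D : {set V}) m : A \subset D ->
  (#|A| <= m <= #|D|)%N -> exists f : {set V}, [/\ A \subset f, f \subset D & #|f| = m].
Proof.
move=> AD /andP[Am mD].
have : (0 < 'C(#|D :\: A|, m - #|A|))%N.
  by rewrite bin_gt0 cardsDS // leq_sub2r.
rewrite -cards_draws card_gt0 => /set0Pn[g]; rewrite inE finset.subsetD => /andP[/andP[gD gA] /eqP cg].
exists (A :|: g)%SET; split; first exact: finset.subsetUl.
  by rewrite finset.subUset AD.
rewrite cardsU cg (_ : A :&: g = finset.set0)%SET ?cards0; first by lia.
by apply/eqP; rewrite finset.setI_eq0 disjoint_sym.
Qed.

Section CyclicColouring.
Variable s' : nat.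
Hypothesis s3 : (s' <= 1)%N.
Local Notation s := s'.+2.
Local Notation col := 'I_s'.+2.

(** Sequences of colours in which some colour [i] is repeated and its cyclic
    predecessor [i - 1] is missing: for two colours the constant ones, for
    three colours those of Turan's construction. *)
Definition cyclic_phi : {set {ffun 'I_s -> col}} :=
  [set tau : {ffun 'I_s -> col} | [exists i, (2 <= #|[set j | tau j == i]%SET|)%N && [forall j, tau j != i - 1]]]%SET.

Lemma third_colour (x i : col) : x != i -> x != i - 1 -> x = i + 1.
Proof.
move: s3 x i; case: s' => [|[|//]] _ [[|[|[|//]]] hx] [[|[|[|//]]] hi] // ; by move=> *; apply: val_inj.
Qed.

Lemma neq_pred (i : col) : i != i - 1.
Proof. by rewrite -subr_eq0 subKr oner_eq0. Qed.

(** Such a sequence is given by [i] and the places that carry [i + 1], of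
    which there are at most [s']; this needs at most three colours. *)
Lemma card_cyclic_phi :
  (#|cyclic_phi| <= s * #|[set A : {set 'I_s} | (#|A| <= s')%N]%SET|)%N.
Proof.
have -> : (s * #|[set A : {set 'I_s} | (#|A| <= s')%N]%SET| =
  #|finset.setX [set: col] [set A : {set 'I_s} | (#|A| <= s')%N]|)%N by rewrite cardsX cardsT card_ord.
pose h (x : col * {set 'I_s}) := [ffun j => if j \in x.2 then x.1 + 1 else x.1].
apply: leq_trans (leq_imset_card h _); apply: subset_leq_card.
apply/fintype.subsetP => tau; rewrite inE => /existsP[i /andP[ci /forallP hi]].
apply/imsetP; exists (i, [set j | tau j != i]%SET).
  rewrite !inE /=; have := cardsC [set j | tau j == i]%SET.
  rewrite (_ : ~: _ = [set j | tau j != i])%SET; last by apply/setP => j; rewrite !inE.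
  move=> e; have := leq_add ci (leqnn #|[set j | tau j != i]%SET|).
  by rewrite e card_ord.
apply/ffunP => j; rewrite ffunE inE /=; case: eqP => [//|/eqP ne] /=.
exact: third_colour.
Qed.

Variables (n : nat) (sigma : 'I_n -> col).

Definition cell (f : {set 'I_n}) (i : col) := [set v in f | sigma v == i]%SET.

Definition cyclic_system : {set {set 'I_n}} :=
  [set f : {set 'I_n} | (#|f| == s) &&
    [exists i, (2 <= #|cell f i|)%N && (cell f (i - 1)%R == finset.set0)]]%SET.

(** An extension is primary if its colour is not the majority colour of
    [f]. *)
Definition minority (f : {set 'I_n}) (w : 'I_n) := (#|cell f (sigma w)| <= 1)%N.

Lemma sum_cell f : (\sum_i #|cell f i| = #|f|)%N.
Proof.
rewrite -sum1_card (partition_big sigma predT) //=; apply: eq_bigr => i _.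
by rewrite -sum1dep_card.
Qed.

(** Some colour occurs twice in [e]. Going back along the cycle of colours
    from it, one meets a colour [i] that occurs twice while [i - 1] occurs at
    most once, since [e] is too small for all colours to occur twice. Dropping
    the vertex of colour [i - 1] leaves enough vertices. *)
Lemma cyclic_turan (e : {set 'I_n}) : #|e| = s.+1 ->
  exists2 f, f \in cyclic_system & f \subset e.
Proof.
move=> ce.
have [i /andP[ci ci1]] : exists i, (2 <= #|cell e i|)%N && (#|cell e (i - 1)%R| <= 1)%N.
  apply/existsP; rewrite -[X in is_true X]negbK; apply/negP => /existsPn no.
  have step i : (2 <= #|cell e i|)%N -> (2 <= #|cell e (i - 1)%R|)%N.
    by move=> h; have := no i; rewrite h /= -ltnNge.
  have [i0 hi0] : exists i, (2 <= #|cell e i|)%N.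
    apply/existsP; rewrite -[X in is_true X]negbK; apply/negP => /existsPn small.
    have : (\sum_i #|cell e i| <= \sum_(i : col) 1)%N.
      by apply: leq_sum => i _; have := small i; rewrite -ltnNge.
    by rewrite sum_cell ce sum1_card card_ord ltnn.
  have iter_step m : (2 <= #|cell e (i0 - m%:R)%R|)%N.
    elim: m => [|m IH]; first by rewrite subr0.
    by rewrite -natr1 opprD addrA; apply: step.
  have all2 i : (2 <= #|cell e i|)%N.
    have := iter_step (i0 - i); rewrite natr_Zp; by rewrite opprB addrC subrK.
  have : (\sum_(i : col) 2 <= \sum_i #|cell e i|)%N by apply: leq_sum.
  rewrite sum_cell ce sum_nat_const card_ord; lia.
pose D := (e :\: cell e (i - 1)%R)%SET.
have cellD : cell e i \subset D.
  apply/fintype.subsetP => v; rewrite !inE => /andP[-> /eqP ->]; rewrite andbT.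
  by rewrite neq_pred.
have cD : (s <= #|D|)%N.
  have sub : cell e (i - 1)%R \subset e by apply/fintype.subsetP => v; rewrite inE => /andP[].
  by rewrite /D cardsDS // ce; move: ci1; lia.
have c2 : (#|(finset.set0 : {set 'I_n})| <= 2 <= #|cell e i|)%N by rewrite cards0.
have [A [_ Ac cA]] := intermediate_subset _ _ _ 2 (finset.sub0set _) c2.
have cAD : (#|A| <= s <= #|D|)%N by rewrite cA cD.
have [f [Af fD cf]] := intermediate_subset _ A D s (fintype.subset_trans Ac cellD) cAD.
exists f; last by apply: fintype.subset_trans fD _; exact: finset.subsetDl.
rewrite inE cf eqxx /=; apply/existsP; exists i; apply/andP; split.
  rewrite -cA; apply: subset_leq_card; apply/fintype.subsetP => v vA.
  by rewrite inE (fintype.subsetP Af v vA); have := fintype.subsetP Ac v vA; rewrite inE => /andP[].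
apply/eqP/setP => v; rewrite !inE; apply/negP => /andP[/(fintype.subsetP fD)].
by rewrite !inE => /andP[/negP nv ve] vi; apply: nv; rewrite ve.
Qed.

Lemma cyclic_majority f : f \in cyclic_system -> exists i, [/\ (2 <= #|cell f i|)%N,
  cell f (i - 1)%R = finset.set0 & forall j, (#|cell f j| <= 1)%N = (j != i)].
Proof.
rewrite inE => /andP[/eqP cf /existsP[i /andP[ci /eqP c0]]]; exists i; split => // j.
have [->|ji] /= := eqVneq j i; first by apply/negbTE; rewrite -ltnNge.
have := sum_cell f; rewrite (bigD1 i) //= (bigD1 j) //= cf; move: s3 ci.
move: #|cell f i| #|cell f j| (\sum_(_ | _) _)%N => a b c; lia.
Qed.

(** If [v] has the majority colour of [f], exchanging any vertex of [f] for
    [v] gives another member of the system, so [l] is the full size of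
    [f]. *)
Lemma cyclic_typed_system :
  typed_system 'I_s n sigma s s.-1 s 0 cyclic_phi finset.set0 cyclic_system minority finset.set0.
Proof.
split.
- by apply/fintype.subsetP => f; rewrite !inE => /andP[].
- exact: cyclic_turan.
- exact: finset.sub0set.
- move=> t ti tF _; rewrite inE; have [i [ci c0 _]] := cyclic_majority _ tF.
  apply/existsP; exists i; apply/andP; split.
    apply: leq_trans ci _; rewrite -(card_imset _ ti); apply: subset_leq_card.
    apply/fintype.subsetP => v; rewrite inE => /andP[/imsetP[j _ ->] sj].
    by apply: imset_f; rewrite inE ffunE.
  apply/forallP => j; rewrite ffunE; apply/negP => sj.
  have : t j \in cell (t @: [set: 'I_s])%SET (i - 1) by rewrite inE imset_f ?inE.
  by rewrite c0 inE.
- by move=> t _; rewrite inE.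
- move=> f fF _; have [i [_ _ hi]] := cyclic_majority f fF.
  exists [set~ i]%SET; rewrite cardsC1 card_ord; split=> // w.
  by rewrite /minority hi !inE.
- move=> f fF _; exists finset.set0; rewrite cards0; split=> // v vf nU _.
  have [i [ci c0 hi]] := cyclic_majority f fF.
  have vi : sigma v = i by move: nU; rewrite /minority hi negbK => /eqP.
  have cf : #|f| = s by move: fF; rewrite inE => /andP[/eqP].
  exists [set ((v |: f) :\ x)%SET | x in f]%SET.
  have inj : {in f &, injective (fun x => (v |: f) :\ x)%SET}.
    move=> x y xf yf /setP/(_ x); rewrite !inE eqxx xf orbT /=.
    by case: eqVneq.
  rewrite card_in_imset // cf; split=> // g /imsetP[x xf ->]; split.
  + rewrite inE cardsDS ?finset.sub1set ?inE ?xf ?orbT // cardsU1 vf cf cards1 /= eqxx /=.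
    apply/existsP; exists i; apply/andP; split.
      apply: (@leq_trans #|(v |: cell f i) :\ x|%SET).
        have : v \notin cell f i by rewrite inE (negbTE vf).
        have := cardsD1 x (v |: cell f i)%SET; rewrite cardsU1 => e1 e2; rewrite e2 in e1.
        by case: (x \in _) e1; lia.
      apply: subset_leq_card; apply/fintype.subsetP => y; rewrite !inE => /andP[->] /=.
      by case/orP => [/eqP ->|/andP[-> ->]]; rewrite ?eqxx ?orbT //= vi eqxx.
    apply/eqP/setP => y; rewrite !inE; apply/negP => /andP[/andP[_ /orP[/eqP ->|yf]] si].
      by move: si; rewrite vi (negbTE (neq_pred i)).
    by have := c0 => /setP/(_ y); rewrite !inE yf si.
  + by rewrite inE.
  + exact: finset.subsetDl.
  + by apply: contraTneq xf => <-; rewrite !inE eqxx.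
Qed.

End CyclicColouring.

Lemma card_cyclic_phi2 : (#|cyclic_phi 0| <= 2)%N.
Proof.
apply: leq_trans (card_cyclic_phi 0 isT) _.
rewrite (_ : [set A : {set 'I_2} | _]%SET = [set finset.set0]%SET) ?cards1 //.
by apply/setP => A; rewrite !inE leqn0 cards_eq0.
Qed.

Lemma card_cyclic_phi3 : (#|cyclic_phi 1| <= 12)%N.
Proof.
apply: leq_trans (card_cyclic_phi 1 isT) _.
rewrite (@leq_pmul2l 3 _ 4) //.
rewrite (_ : [set A : {set 'I_3} | _]%SET = finset.set0 |: [set A : {set 'I_3} | #|A| == 1]%SET)%SET.
  by rewrite cardsU1 card_draws card_ord; case: (_ \notin _).
by apply/setP => A; rewrite !inE -cards_eq0; case: #|A| => [|[|]].
Qed.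

(** * Counting orthogonality relations over the field with two elements *)

(** A self-map of [D] that exchanges [P] with its complement is a bijection
    between the two halves. *)
Lemma card_half (T : finType) (D : {set T}) (P : pred T) (h : T -> T) :
  {in D &, injective h} -> (forall x, x \in D -> (h x \in D) /\ P (h x) = ~~ P x) ->
  (2 * #|[set x in D | P x]%SET| = #|D|)%N.
Proof.
move=> inj hD.
have le (Q : pred T) : (forall x, x \in D -> Q (h x) = ~~ Q x) ->
    (#|[set x in D | Q x]%SET| <= #|[set x in D | ~~ Q x]%SET|)%N.
  move=> hQ; rewrite -(card_in_imset (f := h)); last first.
    by move=> x y; rewrite !inE => /andP[xD _] /andP[yD _]; exact: inj.
  apply: subset_leq_card; apply/fintype.subsetP => _ /imsetP[x + ->]; rewrite inE => /andP[xD Qx].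
  by rewrite inE hQ // Qx; case: (hD x xD) => ->.
have le1 := le P (fun x xD => (hD x xD).2).
have le2 : (#|[set x in D | ~~ P x]%SET| <= #|[set x in D | ~~ ~~ P x]%SET|)%N.
  by apply: (le (fun x => ~~ P x)) => x xD; rewrite (hD x xD).2.
have e2 : [set x in D | ~~ ~~ P x]%SET = [set x in D | P x]%SET.
  by apply/setP => x; rewrite !inE negbK.
rewrite e2 in le2.
have := cardsID [set x | P x]%SET D.
have -> : (D :&: [set x | P x] = [set x in D | P x])%SET by apply/setP => x; rewrite !inE.
have -> : (D :\: [set x | P x] = [set x in D | ~~ P x])%SET by apply/setP => x; rewrite !inE andbC.
move: le1 le2; lia.
Qed.

Section Giraud.
Variable K : nat.
Local Notation X := 'rV['F_2]_K.
Local Notation T := (bool * 'rV['F_2]_K)%type.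

Definition dot (x y : X) : 'F_2 := (x *m y^T) 0 0.

Lemma F2_cases (a : 'F_2) : a = 0 \/ a = 1.
Proof. by case: a => [[|[|//]] h]; [left|right]; apply: val_inj. Qed.

Lemma addrr_F2 (a : 'F_2) : a + a = 0.
Proof. by case: (F2_cases a) => ->; apply: val_inj. Qed.

Lemma addrr_vec (x : X) : x + x = 0.
Proof. by apply/rowP => i; rewrite !mxE addrr_F2. Qed.

Lemma addvK (x y : X) : x + y + y = x.
Proof. by rewrite -addrA addrr_vec addr0. Qed.

Lemma addv_neq0 (x y : X) : x != y -> x + y != 0.
Proof. by apply: contraNneq => xy; rewrite -(addvK x y) xy add0r. Qed.

Lemma dotDl x y z : dot (x + y) z = dot x z + dot y z.
Proof. by rewrite /dot mulmxDl mxE. Qed.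

Lemma dotDr x y z : dot x (y + z) = dot x y + dot x z.
Proof. by rewrite /dot linearD /= mulmxDr mxE. Qed.

Lemma dotC x y : dot x y = dot y x.
Proof.
have e : y *m x^T = (x *m y^T)^T by rewrite trmx_mul trmxK.
by rewrite /dot e [RHS]mxE.
Qed.

Lemma dot_nondegenerate (z : X) : z != 0 -> exists e, dot z e = 1.
Proof.
move=> /rV0Pn[i zi]; exists (delta_mx 0 i).
rewrite /dot mxE (bigD1 i) //= big1 ?addr0.
  by rewrite !mxE !eqxx mulr1; case: (F2_cases (z 0 i)) zi => -> //; rewrite eqxx.
by move=> j ji; rewrite !mxE (negbTE ji) andbF mulr0.
Qed.

Lemma neq0_add1 (a : 'F_2) : (a + 1 != 0) = ~~ (a != 0).
Proof. by case: (F2_cases a) => ->. Qed.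

Lemma card_dot_neq0 (z : X) (c : 'F_2) : z != 0 -> (2 * #|[set y | (dot z y + c != 0)%R]%SET| = #|X|)%N.
Proof.
move=> /dot_nondegenerate[e ze].
rewrite -[#|X|]cardsT -(card_half _ [set: X]%SET (fun y => dot z y + c != 0) (fun y => y + e)).
- by congr (_ * _)%N; apply: eq_card => y; rewrite !inE.
- by move=> x y _ _ /addIr.
- by move=> y _; rewrite inE dotDr ze addrAC neq0_add1.
Qed.

(** The parity condition on a 4-set with two vertices on each side, [A] being
    the places on one side. *)
Definition giraud_cond (A : {set 'I_4}) (xi : {ffun 'I_4 -> X}) :=
  dot (\sum_(j in A) xi j) (\sum_(j in ~: A) xi j) == 0.

(** The condition is affine in each vector outside [A]; adding to one of them
    a vector not orthogonal to the sum over [A] reverses it. *)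
Lemma card_giraud_cond (A : {set 'I_4}) : #|A| = 2 ->
  (2 * #|[set xi : {ffun 'I_4 -> X} | (\sum_(j in A) xi j != 0)%R && giraud_cond A xi]%SET| <= #|X| ^ 4)%N.
Proof.
move=> cA.
have [j0 j0A] : exists j0, j0 \in (~: A)%SET.
  by apply/set0Pn; rewrite -card_gt0 cardsCs finset.setCK card_ord cA.
pose e (z : X) := odflt 0 [pick e | dot z e == 1].
have eP z : z != 0 -> dot z (e z) = 1.
  move=> /dot_nondegenerate[e0 ze]; rewrite /e; case: pickP => [x /eqP|/(_ e0)] //=.
  by rewrite ze eqxx.
pose S (xi : {ffun 'I_4 -> X}) := \sum_(j in A) xi j.
pose h (xi : {ffun 'I_4 -> X}) : {ffun 'I_4 -> X} := [ffun j => if j == j0 then xi j + e (S xi) else xi j].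
have hS xi : S (h xi) = S xi.
  apply: eq_bigr => j jA; rewrite ffunE; case: eqP => // jj.
  by move: j0A; rewrite -jj inE jA.
have hC xi : \sum_(j in ~: A) h xi j = \sum_(j in ~: A) xi j + e (S xi).
  rewrite (bigD1 j0) //= [in RHS](bigD1 j0) //= ffunE eqxx addrAC; congr (_ + _ + _).
  by apply: eq_bigr => j /andP[_ jj]; rewrite ffunE (negbTE jj).
pose D := [set xi : {ffun 'I_4 -> X} | S xi != 0]%SET.
have -> : [set xi : {ffun 'I_4 -> X} | (\sum_(j in A) xi j != 0)%R && giraud_cond A xi]%SET =
   [set xi in D | giraud_cond A xi]%SET by apply/setP => xi; rewrite !inE.
rewrite (card_half _ D (giraud_cond A) h).
- by rewrite -[X in (_ <= _ ^ X)%N](card_ord 4) -card_ffun max_card.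
- move=> x y _ _ hxy; have Sxy : S x = S y by rewrite -hS hxy hS.
  apply/ffunP => j; have := congr1 (fun g : {ffun 'I_4 -> X} => g j) hxy.
  by rewrite /h !ffunE Sxy; case: eqP => // _ /addIr.
- move=> xi; rewrite inE => Sxi; rewrite inE hS Sxi; split=> //.
  rewrite /giraud_cond -/(S (h xi)) hS hC dotDr eP //.
  by rewrite -/(S xi) -[RHS]negbK -neq0_add1 negbK.
Qed.

Definition giraud_phi : {set {ffun 'I_4 -> T}} :=
  [set tau : {ffun 'I_4 -> T} | injectiveb tau &&
    [exists s, let A := [set j | (tau j).1 == s]%SET in
      (#|A| == 4) || ((#|A| == 2) && giraud_cond A [ffun j => (tau j).2])]]%SET.

Lemma giraud_condC A xi : giraud_cond (~: A)%SET xi = giraud_cond A xi.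
Proof. by rewrite /giraud_cond finset.setCK dotC. Qed.

(** Up to coinciding types, two of the sixteen patterns of sides are always
    admitted and six of them for half of the vectors: [2 + 6 / 2 = 5]. *)
Lemma card_giraud_phi : (#|giraud_phi| <= 5 * #|X| ^ 4)%N.
Proof.
pose g (tau : {ffun 'I_4 -> T}) : {set 'I_4} * {ffun 'I_4 -> X} :=
  ([set j | (tau j).1]%SET, [ffun j => (tau j).2]).
have ginj : injective g.
  move=> t u [/setP e1 /ffunP e2]; apply/ffunP => j; move: (e1 j) (e2 j).
  by rewrite !inE !ffunE; case: (t j) (u j) => [a b] [c d] /= -> ->.
pose P1 := finset.setX [set (finset.set0 : {set 'I_4}); [set: 'I_4]] [set: {ffun 'I_4 -> X}].
pose P2 := [set u : {set 'I_4} * {ffun 'I_4 -> X} | (#|u.1| == 2) &&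
   ((\sum_(j in u.1) u.2 j != 0) && giraud_cond u.1 u.2)]%SET.
have c1 : (#|P1| <= 2 * #|X| ^ 4)%N.
  rewrite /P1 cardsX cardsT card_ffun card_ord leq_mul2r; apply/orP; right.
  by rewrite cards2; case: (_ != _).
have c2 : (#|P2| <= 3 * #|X| ^ 4)%N.
  rewrite -(@leq_pmul2l 2) // mulnA.
  have -> : #|P2| = (\sum_(A : {set 'I_4} | #|A| == 2)
     #|[set xi : {ffun 'I_4 -> X} | (\sum_(j in A) xi j != 0)%R && giraud_cond A xi]%SET|)%N.
    rewrite -sum1_card; under [RHS]eq_bigr => A _ do rewrite -sum1_card.
    by rewrite pair_big_dep /=; apply: eq_bigl => u; rewrite !inE.
  rewrite big_distrr /=.
  apply: (@leq_trans (\sum_(A : {set 'I_4} | #|A| == 2) #|X| ^ 4)%N).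
    by apply: leq_sum => A /eqP; exact: card_giraud_cond.
  by rewrite sum_nat_const -cardsE card_draws card_ord.
rewrite -(card_imset _ ginj); apply: (@leq_trans #|P1 :|: P2|%SET); last first.
  by apply: leq_trans (leq_card_setU _ _) _; rewrite (mulnDl 2 3) leq_add.
apply: subset_leq_card; apply/fintype.subsetP => _ /imsetP[tau + ->].
rewrite inE => /andP[/injectiveP inj /existsP[s]] /=.
set A := [set j | (tau j).1]%SET.
have CA : [set j | (tau j).1 == false]%SET = (~: A)%SET.
  by apply/setP => j; rewrite !inE eqbF_neg.
have TA : [set j | (tau j).1 == true]%SET = A.
  by apply/setP => j; rewrite !inE eqb_id.
have cAC : (#|A| + #|~: A| = 4)%N by rewrite cardsC card_ord.
have pairP : (#|A| == 2) && giraud_cond A [ffun j => (tau j).2] -> g tau \in P2.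
  move=> /andP[cA gA]; rewrite inE /= -/A cA gA andbT /=.
  move: cA => /cards2P[i [i' [ii' AE]]].
  rewrite AE big_setU1 ?inE //= big_set1 !ffunE; apply: addv_neq0.
  have si k : k \in A -> (tau k).1 by rewrite inE.
  have s1 := si i; have s2 := si i'; rewrite AE !inE !eqxx ?orbT in s1 s2.
  apply: contraNneq ii' => e; apply/eqP/inj.
  by move: (s1 isT) (s2 isT) e; case: (tau i) (tau i') => [a b] [c d] /= -> -> ->.
rewrite inE; case: s; rewrite ?TA ?CA => /orP[c4|cc].
- have AE : A = [set: 'I_4]%SET.
    by apply/eqP; rewrite eqEcard finset.subsetT cardsT card_ord (eqP c4).
  by rewrite finset.in_setX /= -/A AE !inE eqxx orbT.
- by rewrite (pairP cc) orbT.
- have AE : A = finset.set0 by apply/eqP; rewrite -cards_eq0; move: cAC; rewrite (eqP c4); move: #|A| => a; lia.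
  by rewrite finset.in_setX /= -/A AE !inE eqxx.
- rewrite pairP ?orbT //; move: cc; rewrite giraud_condC => /andP[/eqP c2' ->].
  by rewrite andbT; move: cAC; rewrite c2'; move: #|A| => a; lia.
Qed.

End Giraud.

(** * Giraud's construction *)

Section GiraudSystem.
Variables (K n : nat).
Local Notation X := 'rV['F_2]_K.
Local Notation T := (bool * 'rV['F_2]_K)%type.
Variable sigma : 'I_n -> T.
Local Notation side v := (sigma v).1.
Local Notation vec v := (sigma v).2.
Implicit Types (f e : {set 'I_n}) (s : bool).

Definition part f s := [set v in f | side v == s]%SET.
Definition vsum f s : X := \sum_(v in part f s) vec v.

(** Giraud's construction: 4-sets on one side, and 4-sets with two vertices on
    each side for which the 2 by 2 minor of the matrix of inner products
    between the two sides has an even number of ones. By bilinearity the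
    latter says that the sums of the vectors on the two sides are
    orthogonal. *)
Definition giraud_system : {set {set 'I_n}} :=
  [set f : {set 'I_n} | (#|f| == 4) && [exists s, (#|part f s| == 4) ||
     ((#|part f s| == 2) && (dot K (vsum f s) (vsum f (~~ s)) == 0)%R)]]%SET.

(** A pair with equal types makes a sum of two vectors vanish, and then the
    parity condition no longer splits the types in half. *)
Definition giraud_exc : {set {set 'I_n}} :=
  [set f in giraud_system | [exists u in f, exists v in f, (u != v) && (sigma u == sigma v)]]%SET.

(** Primary extensions: one vertex on the other side for a 4-set on one side,
    and otherwise a vertex whose row of the minor differs from the two equal
    rows that it joins. *)
Definition odd_one_out f w :=
  if #|part f (side w)| == 2 then
    [exists a in part f (side w), dot K (vec w + vec a) (vsum f (~~ side w)) != 0]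
  else #|part f (side w)| == 0%N.

Definition quad s x x' y y' := [/\ x != x', y != y', side x = s, side x' = s &
  (side y = ~~ s /\ side y' = ~~ s)].

Lemma quad_swap s x x' y y' : quad s x x' y y' -> quad (~~ s) y y' x x'.
Proof. by case=> ? ? ? ? [? ?]; split=> //; rewrite negbK. Qed.

Lemma quad_part s x x' y y' : quad s x x' y y' ->
  part [set x; x'; y; y']%SET s = [set x; x']%SET.
Proof.
move=> [_ _ sx sx' [sy sy']]; apply/setP => v; rewrite !inE.
have [->|] := eqVneq v x; first by rewrite sx eqxx.
have [->|] := eqVneq v x'; first by rewrite sx' eqxx orbT.
have [->|_] := eqVneq v y; first by rewrite sy; case: (s).
by have [->|//] := eqVneq v y'; rewrite sy'; case: (s).
Qed.

Lemma quad_set_swap (x x' y y' : 'I_n) : [set x; x'; y; y']%SET = [set y; y'; x; x']%SET.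
Proof.
by apply/setP => v; rewrite !inE; do 4! [case: (_ == _)].
Qed.

Lemma quad_partN s x x' y y' : quad s x x' y y' ->
  part [set x; x'; y; y']%SET (~~ s) = [set y; y']%SET.
Proof. by move=> /quad_swap/quad_part <-; rewrite quad_set_swap. Qed.

Lemma vsum_pair f s x x' : part f s = [set x; x']%SET -> x != x' -> vsum f s = vec x + vec x'.
Proof. by move=> p xx'; rewrite /vsum p big_setU1 ?inE //= big_set1. Qed.

Lemma card_quad s x x' y y' : quad s x x' y y' -> #|[set x; x'; y; y']%SET| = 4%N.
Proof.
move=> [xx' yy' sx sx' [sy sy']].
have ne u v : side u = s -> side v = ~~ s -> u != v.
  by move=> su sv; apply/eqP => uv; move: sv; rewrite -uv su; case: (s).
rewrite -!finset.setUA !cardsU1 cards1 !inE !negb_or.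
by rewrite xx' yy' !ne.
Qed.

Lemma quad_giraud s x x' y y' : quad s x x' y y' ->
  dot K (vec x + vec x') (vec y + vec y') = 0 -> [set x; x'; y; y']%SET \in giraud_system.
Proof.
move=> q d; have [xx' yy' _ _ _] := q.
rewrite inE (card_quad _ _ _ _ _ q) eqxx /=; apply/existsP; exists s.
rewrite (vsum_pair _ _ _ _ (quad_part _ _ _ _ _ q) xx').
rewrite (vsum_pair _ _ _ _ (quad_partN _ _ _ _ _ q) yy') d eqxx andbT.
by rewrite (quad_part _ _ _ _ _ q) cards2 xx' orbT.
Qed.

Lemma card_part f s : (#|part f s| + #|part f (~~ s)| = #|f|)%N.
Proof.
rewrite -(cardsID [set v | side v == s]%SET f); congr (_ + _)%N; apply: eq_card => v; rewrite !inE //.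
by rewrite andbC; case: (side v) (s) => [] [].
Qed.

Lemma mono_giraud f s : #|f| = 4%N -> (forall v, v \in f -> side v = s) ->
  part f s = f /\ f \in giraud_system.
Proof.
move=> cf fs; have pf : part f s = f.
  by apply/setP => v; rewrite !inE; case vf: (v \in f) => //=; rewrite fs ?eqxx.
by split=> //; rewrite inE cf eqxx; apply/existsP; exists s; rewrite pf cf eqxx.
Qed.

Lemma part_eq2 f s : #|part f s| = 2%N -> #|part f (~~ s)| = 2%N ->
  exists x x' y y', quad s x x' y y' /\ f = [set x; x'; y; y']%SET.
Proof.
move=> /eqP/cards2P[x [x' [xx' px]]] /eqP/cards2P[y [y' [yy' py]]].
have inx v : v \in part f s -> side v = s by rewrite inE => /andP[_ /eqP].
have iny v : v \in part f (~~ s) -> side v = ~~ s by rewrite inE => /andP[_ /eqP].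
exists x, x', y, y'; split.
  split => //; [apply: inx|apply: inx|split; apply: iny];
    by rewrite ?px ?py !inE eqxx ?orbT.
rewrite -!finset.setUA finset.setUA -px -py; apply/setP => v; rewrite !inE.
by case: (v \in f) => //=; case: (side v) (s) => [] [].
Qed.

Lemma giraudP f : f \in giraud_system ->
  (exists s, #|f| = 4%N /\ forall v, v \in f -> side v = s) \/
  (exists s x x' y y', [/\ quad s x x' y y', f = [set x; x'; y; y']%SET &
      dot K (vec x + vec x') (vec y + vec y') = 0]).
Proof.
rewrite inE => /andP[/eqP cf /existsP[s /orP[/eqP p4|/andP[/eqP p2 /eqP d]]]].
  left; exists s; split=> // v vf.
  have : v \in part f s.
    suff -> : part f s = f by [].
    apply/eqP; rewrite eqEcard p4 cf leqnn andbT.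
    by apply/fintype.subsetP => u; rewrite inE => /andP[].
  by rewrite inE => /andP[_ /eqP].
right; exists s; have p2' : #|part f (~~ s)| = 2%N by have := card_part f s; rewrite cf p2; lia.
have [x [x' [y [y' [q fE]]]]] := part_eq2 f s p2 p2'.
exists x, x', y, y'; split=> //; have [xx' yy' _ _ _] := q.
move: d; rewrite fE (vsum_pair _ _ _ _ (quad_part _ _ _ _ _ q) xx').
by rewrite (vsum_pair _ _ _ _ (quad_partN _ _ _ _ _ q) yy').
Qed.

(** Some side contains three vertices of [e]. If it contains exactly three,
    two of these have the same inner product with the sum of the other two
    vertices, and the four together satisfy the parity condition. *)
Lemma giraud_turan e : #|e| = 5%N -> exists2 f, f \in giraud_system & f \subset e.
Proof.
move=> ce.
have [s hs] : exists s, (3 <= #|part e s|)%N.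
  have := card_part e true; rewrite ce /= => h.
  have [h3|h3] := leqP 3 #|part e true|; first by exists true.
  by exists false; move: h h3; move: #|part e true| #|part e false| => a b; lia.
have sub s' : part e s' \subset e by apply/fintype.subsetP => v; rewrite inE => /andP[].
have [h4|h3] := leqP 4 #|part e s|.
  have c4 : (#|(finset.set0 : {set 'I_n})| <= 4 <= #|part e s|)%N by rewrite cards0.
  have [f [_ fp cf]] := intermediate_subset _ _ _ 4 (finset.sub0set _) c4.
  exists f; last exact: fintype.subset_trans fp (sub s).
  apply: (proj2 (mono_giraud f s cf _)) => v /(fintype.subsetP fp).
  by rewrite inE => /andP[_ /eqP].
have p3 : #|part e s| = 3%N by apply/eqP; rewrite eqn_leq hs -ltnS h3.
have p2 : #|part e (~~ s)| = 2%N by have := card_part e s; rewrite ce p3; lia.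
have /eqP/cards2P[y [y' [yy' py]]] := p2.
pose g v := dot K (vec v) (vec y + vec y').
have [x [x' [xp xp' xx' gx]]] : exists x x', [/\ x \in part e s, x' \in part e s, x != x' & g x = g x'].
  have [/dinjectiveP dinj|] := boolP (dinjectiveb g (part e s)).
    have := max_card (mem (g @: part e s)%SET).
    by rewrite (card_in_imset dinj) p3 card_ord.
  by move=> /dinjectivePn[x xp [x' /andP[/= xx' xp'] gx]]; exists x, x'; split=> //; rewrite eq_sym.
have ss s' v : v \in part e s' -> v \in e /\ side v = s' by rewrite inE => /andP[-> /eqP].
have [xe sx] := ss _ _ xp; have [xe' sx'] := ss _ _ xp'.
have [ye sy] : y \in e /\ side y = ~~ s by apply: ss; rewrite py !inE eqxx.
have [ye' sy'] : y' \in e /\ side y' = ~~ s by apply: ss; rewrite py !inE eqxx orbT.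
exists [set x; x'; y; y']%SET.
  apply: (quad_giraud s); first by split.
  by rewrite dotDl -/(g x) gx addrr_F2.
by apply/fintype.subsetP => v; rewrite !inE => /orP[/orP[/orP[]|]|] /eqP ->.
Qed.

Lemma giraud_goodP f : f \in giraud_system -> f \notin giraud_exc -> {in f &, injective sigma}.
Proof.
move=> fF; rewrite inE fF /= => /exists_inPn h u v uf vf uv.
have := h u uf => /exists_inPn/(_ v vf); rewrite uv eqxx andbT negbK.
by move/eqP.
Qed.

Lemma giraud_good f : f \in giraud_system -> {in f &, injective sigma} -> f \notin giraud_exc.
Proof.
move=> fF inj; rewrite inE fF /=; apply/exists_inPn => u uf; apply/exists_inPn => v vf.
by apply/negP => /andP[/eqP uv /eqP /(inj u v uf vf)].
Qed.

Lemma vec_neq s u v : side u = s -> side v = s -> sigma u != sigma v -> vec u != vec v.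
Proof.
move=> su sv; apply: contra => /eqP e; apply/eqP; move: su sv e.
by case: (sigma u) (sigma v) => [a b] [c d] /= -> -> ->.
Qed.

Lemma odd_one_out_mono f s w : #|f| = 4%N -> (forall v, v \in f -> side v = s) ->
  odd_one_out f w = (side w != s).
Proof.
move=> cf fs; have [pf _] := mono_giraud f s cf fs.
rewrite /odd_one_out; have [->|ne] := eqVneq (side w) s; first by rewrite pf cf.
have -> : side w = ~~ s by case: (side w) (s) ne => [] [].
have -> : #|part f (~~ s)| = 0%N by have := card_part f s; rewrite pf cf; lia.
by [].
Qed.

(** The answer is the same for [x] and [x'], because [x + x'] is orthogonal to
    [y + y']. *)
Lemma odd_one_out_quad s x x' y y' w : quad s x x' y y' ->
  dot K (vec x + vec x') (vec y + vec y') = 0 -> side w = s ->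
  odd_one_out [set x; x'; y; y']%SET w = (dot K (vec w + vec x) (vec y + vec y') != 0).
Proof.
move=> q d sw; have [xx' yy' _ _ _] := q.
rewrite /odd_one_out sw (quad_part _ _ _ _ _ q) cards2 xx' /=.
rewrite (vsum_pair _ _ _ _ (quad_partN _ _ _ _ _ q) yy').
have e : dot K (vec w + vec x') (vec y + vec y') = dot K (vec w + vec x) (vec y + vec y').
  rewrite -[LHS]addr0 -d -dotDl; congr (dot K _ _).
  by rewrite [vec x + _]addrC addrA addvK.
apply/exists_inP/idP => [[a]|h]; last by exists x; rewrite ?inE ?eqxx.
by rewrite !inE => /orP[/eqP ->|/eqP ->]; rewrite ?e.
Qed.

Lemma card_type_set s (a b : X) (c c' : 'F_2) : a != 0 -> b != 0 ->
  #|[set t : T | if t.1 == s then (dot K a t.2 + c != 0) else (dot K b t.2 + c' != 0)]%SET| = #|X|.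
Proof.
move=> a0 b0; have ha := card_dot_neq0 K a c a0; have hb := card_dot_neq0 K b c' b0.
pose A := [set y : X | (dot K a y + c != 0)%R]%SET.
pose B := [set y : X | (dot K b y + c' != 0)%R]%SET.
have -> : [set t : T | if t.1 == s then (dot K a t.2 + c != 0) else (dot K b t.2 + c' != 0)]%SET
   = (finset.setX [set s] A :|: finset.setX [set ~~ s] B)%SET.
  by apply/setP => [[u v]]; rewrite !inE /=; case: u (s) => [] [] /=; rewrite ?orbF.
rewrite cardsU !cardsX !cards1 !mul1n.
rewrite (_ : _ :&: _ = finset.set0)%SET ?cards0.
  move: ha hb; rewrite -/A -/B; move: #|A| #|B| #|X| => i j k; lia.
by apply/setP => [[u v]]; rewrite !inE /=; case: u (s) => [] [] /=; rewrite ?andbF.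
Qed.

Lemma giraud_primary f : f \in giraud_system -> f \notin giraud_exc ->
  exists A : {set T}, #|A| = #|X| /\ forall w, odd_one_out f w = (sigma w \in A).
Proof.
move=> fF fE; have inj := giraud_goodP f fF fE.
have [[s [cf fs]]|[s [x [x' [y [y' [q fE' d]]]]]]] := giraudP f fF.
  exists (finset.setX [set ~~ s] [set: X])%SET; split; first by rewrite cardsX cards1 mul1n cardsT.
  move=> w; rewrite (odd_one_out_mono f s) // !inE andbT.
  by case: (side w) (s) => [] [].
have [xx' yy' sx sx' [sy sy']] := q.
have X0 : vec x + vec x' != 0.
  apply: addv_neq0; apply: (vec_neq s) => //.
  by apply: contra xx' => /eqP/inj ->; rewrite // fE' !inE eqxx ?orbT.
have Y0 : vec y + vec y' != 0.
  apply: addv_neq0; apply: (vec_neq (~~ s)) => //.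
  by apply: contra yy' => /eqP/inj ->; rewrite // fE' !inE eqxx ?orbT.
exists [set t : T | if t.1 == s then
   (dot K (vec y + vec y') t.2 + dot K (vec y + vec y') (vec x) != 0)
   else (dot K (vec x + vec x') t.2 + dot K (vec x + vec x') (vec y) != 0)]%SET.
split; first exact: card_type_set.
move=> w; rewrite inE -!dotDr; case: eqP => [sw|/eqP sw].
  by rewrite fE' (odd_one_out_quad s) // dotC.
have sw' : side w = ~~ s by case: (side w) (s) sw => [] [].
rewrite fE' quad_set_swap (odd_one_out_quad (~~ s)) //; first by rewrite dotC.
  exact: quad_swap.
by rewrite dotC.
Qed.

Lemma set_swap1 (x x' y y' v : 'I_n) : v \notin [set x; x'; y; y']%SET -> x \notin [set x'; y; y']%SET ->
  ((v |: [set x; x'; y; y']) :\ x)%SET = [set v; x'; y; y']%SET.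
Proof.
move=> vf xn; apply/setP => u; rewrite !inE; have [->|ux] /= := eqVneq u x; last by rewrite !orbA.
move: vf xn; rewrite !inE !negb_or => /andP[/andP[/andP[vx _] _] _] /andP[/andP[xx' xy] xy'].
by rewrite [x == v]eq_sym (negbTE vx) (negbTE xx') (negbTE xy) (negbTE xy').
Qed.

(** If [f] has two vertices on each side, a vertex that is not primary has the
    same row as the two vertices of its side, so that it can replace either of
    them. *)
Lemma giraud_exchange f v x : f \in giraud_system -> v \notin f -> ~~ odd_one_out f v ->
  x \in part f (side v) -> ((v |: f) :\ x)%SET \in giraud_system.
Proof.
move=> fF vf nU; rewrite inE => /andP[xf /eqP sxv].
have [[s [cf fs]]|[s0 [z0 [z0' [y0 [y0' [q0 fE0 d0]]]]]]] := giraudP f fF.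
  have sv : side v = s by move: nU; rewrite (odd_one_out_mono f s) // negbK => /eqP.
  apply: (proj2 (mono_giraud _ s _ _)).
    by have := cardsD1 x (v |: f)%SET; rewrite cardsU1 vf cf !inE xf orbT => /esym/eqP; rewrite eqSS => /eqP.
  by move=> u; rewrite !inE => /andP[_ /orP[/eqP ->|/fs]].
have [s [z [z' [y [y' [q fE d sv]]]]]] : exists s z z' y y', [/\ quad s z z' y y',
    f = [set z; z'; y; y']%SET, dot K (vec z + vec z') (vec y + vec y') = 0 & side v = s].
  have [sv|/eqP sv] := eqVneq (side v) s0; first by exists s0, z0, z0', y0, y0'.
  exists (~~ s0), y0, y0', z0, z0'; split.
  - exact: quad_swap.
  - by rewrite fE0 quad_set_swap.
  - by rewrite dotC.
  - by case: (side v) (s0) sv => [] [].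
have [zz' yy' sz sz' [sy sy']] := q.
have main z1 z2 : quad s z1 z2 y y' -> f = [set z1; z2; y; y']%SET ->
    dot K (vec z1 + vec z2) (vec y + vec y') = 0 -> ((v |: f) :\ z1)%SET \in giraud_system.
  move=> q1 f1 d1; have [z12 _ s1 s2 _] := q1.
  have dv : dot K (vec v + vec z1) (vec y + vec y') = 0.
    by move: nU; rewrite f1 (odd_one_out_quad s) // negbK => /eqP.
  have vz2 : v != z2 by apply: contraNneq vf => ->; rewrite f1 !inE eqxx orbT.
  rewrite f1 set_swap1; last 2 first.
  - by rewrite -f1.
  - rewrite !inE !negb_or z12 /=; apply/andP; split; apply/eqP => e.
      by move: s1; rewrite e sy; case: (s).
    by move: s1; rewrite e sy'; case: (s).
  apply: (quad_giraud s); first by split.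
  rewrite -(addvK K (vec v) (vec z1)) -addrA dotDl dv add0r; exact: d1.
have xz : x \in [set z; z']%SET.
  by rewrite -(quad_part _ _ _ _ _ q) inE -fE xf -sv sxv eqxx.
case/set2P: xz => ->; first exact: (main z z').
apply: (main z' z).
- by split; rewrite // eq_sym.
- by rewrite fE; apply/setP => u; rewrite !inE; do 4! [case: (_ == _)].
- by rewrite [vec z' + _]addrC.
Qed.

Lemma giraud_part_ge2 f v : f \in giraud_system -> ~~ odd_one_out f v ->
  (2 <= #|part f (side v)|)%N.
Proof.
move=> fF nU; have [[s [cf fs]]|[s [x [x' [y [y' [q fE d]]]]]]] := giraudP f fF.
  have sv : side v = s by move: nU; rewrite (odd_one_out_mono f s) // negbK => /eqP.
  by rewrite sv (proj1 (mono_giraud f s cf fs)) cf.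
have [xx' yy' _ _ _] := q.
have [->|/eqP sv] := eqVneq (side v) s.
  by rewrite fE (quad_part _ _ _ _ _ q) cards2 xx'.
have -> : side v = ~~ s by case: (side v) (s) sv => [] [].
by rewrite fE (quad_partN _ _ _ _ _ q) cards2 yy'.
Qed.

Definition noninj_types : {set {ffun 'I_4 -> T}} := [set tau : {ffun 'I_4 -> T} | ~~ injectiveb tau]%SET.

(** The four types of [f] itself are bad for [v]: they would make the sets
    obtained by exchange exceptional. The system has [l = 2], because the side
    of [v] contains two or four vertices of [f]. *)
Lemma giraud_typed_system :
  typed_system T n sigma 4 #|X| 2 4 (giraud_phi K) noninj_types giraud_system odd_one_out giraud_exc.
Proof.
split.
- by apply/fintype.subsetP => f; rewrite !inE => /andP[].
- exact: giraud_turan.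
- by apply/fintype.subsetP => f; rewrite inE => /andP[].
- move=> t ti tF tE; have inj := giraud_goodP _ tF tE.
  rewrite inE; apply/andP; split.
    by apply/injectiveP => i j; rewrite !ffunE => /inj e; apply/ti/e; rewrite imset_f ?inE.
  have partE s : part (t @: [set: 'I_4])%SET s = (t @: [set j | side (t j) == s])%SET.
    apply/setP => v; rewrite inE; apply/andP/imsetP => [[/imsetP[j _ ->] sj]|[j + ->]].
      by exists j; rewrite ?inE.
    by rewrite inE => sj; rewrite imset_f ?inE.
  have AE s : [set j | ([ffun i => sigma (t i)] j).1 == s]%SET = [set j | side (t j) == s]%SET.
    by apply/setP => j; rewrite !inE ffunE.
  move: tF; rewrite inE => /andP[_ /existsP[s hs]]; apply/existsP; exists s => /=.
  rewrite AE; move: hs; rewrite partE card_imset //.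
  suff -> : giraud_cond K [set j | side (t j) == s]%SET [ffun j => ([ffun i => sigma (t i)] j).2] =
     (dot K (vsum (t @: [set: 'I_4]) s) (vsum (t @: [set: 'I_4]) (~~ s)) == 0) by [].
  rewrite /giraud_cond /vsum !partE !big_imset /=; try by move=> ? ? _ _; exact: ti.
  have -> : (~: [set j | side (t j) == s])%SET = [set j | side (t j) == ~~ s]%SET.
    by apply/setP => j; rewrite !inE; case: (side _) (s) => [] [].
  by congr (dot K _ _ == 0); apply: eq_bigr => j _; rewrite !ffunE.
- move=> t ti; rewrite inE => /andP[_ /exists_inP[u ut /exists_inP[v vt /andP[uv /eqP suv]]]].
  move: ut vt uv suv => /imsetP[i _ ->] /imsetP[j _ ->] tij sij.
  rewrite inE; apply/injectivePn; exists i, j; last by rewrite !ffunE.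
  by apply: contra tij => /eqP ->.
- exact: giraud_primary.
- move=> f fF fE; have inj := giraud_goodP f fF fE.
  exists (sigma @: f)%SET; split.
    by apply: leq_trans (leq_imset_card _ _) _; move: fF; rewrite inE => /andP[/eqP ->].
  move=> v vf nU sv.
  exists [set ((v |: f) :\ x)%SET | x in part f (side v)]%SET.
  have pf x : x \in part f (side v) -> x \in f by rewrite inE => /andP[].
  have injx : {in part f (side v) &, injective (fun x => (v |: f) :\ x)%SET}.
    move=> x y /pf xf /pf yf /setP/(_ x); rewrite !inE eqxx xf orbT /=.
    by case: eqVneq.
  rewrite card_in_imset //; split; first exact: giraud_part_ge2.
  move=> g /imsetP[x xp ->]; have xf := pf x xp.
  have gF := giraud_exchange f v x fF vf nU xp.
  split=> //.
  + apply: giraud_good => // a b.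
    have sf c : c \in f -> sigma v <> sigma c.
      by move=> cf e; move: sv; rewrite e imset_f.
    rewrite !inE => /andP[_ /orP[/eqP ->|af]] /andP[_ /orP[/eqP ->|bf]] //.
    * by move=> /sf; move=> /(_ bf).
    * by move=> /esym/sf; move=> /(_ af).
    * exact: inj.
  + exact: finset.subsetDl.
  + by apply: contraTneq xf => <-; rewrite !inE eqxx.
Qed.

End GiraudSystem.

(** * The bound *)

Section Assembly.
Context {R : realType}.

(** Here [kappa] is [s (s - 1) / s] with [s = s'.+2]: all [s] exchanges are
    available, and [s - 1] of the [s] colours are primary. *)
Lemma cyclic_scheme (s' : nat) (pi : R) : (s' <= 1)%N -> 0 <= pi <= 1 ->
  #|cyclic_phi s'|%:R <= pi * (s'.+2)%:R ^+ s'.+2 ->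
  forall eta : R, 0 < eta -> \forall n \near \oo%classic,
    exists F U E, scheme s'.+2 n pi (s'.+1%:R / s'.+2%:R) (s'.+1%:R) eta F U E.
Proof.
move=> s1 pi01 cphi eta e0.
have h : 0 <= eta / 8 * #|'I_s'.+2|%:R ^+ s'.+2 by rewrite mulr_ge0 ?exprn_ge0 // divr_ge0 // ltW.
have h2 : 0 <= eta / 2 * #|'I_s'.+2|%:R by rewrite mulr_ge0 // divr_ge0 // ltW.
have := typed_system_scheme 'I_s'.+2 s'.+2 s'.+1 s'.+2 0 (cyclic_phi s') finset.set0 pi eta.
rewrite cards0 !card_ord => /(_ isT e0 pi01 cphi) key.
rewrite !card_ord in h h2; have {key} key := key h h2.
apply: filterS key => n sch.
have [sigma eqs] := @equitable_exists R 'I_s'.+2 ord0 n.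
exists (cyclic_system s' n sigma), (minority s' n sigma), finset.set0.
have := sch sigma _ _ _ eqs (cyclic_typed_system s' s1 n sigma).
by rewrite (_ : (s'.+2 * s'.+1)%:R / s'.+2%:R = s'.+1%:R) // natrM mulrAC divff ?mul1r // pnatr_eq0.
Qed.

(** Half of the types are primary and two exchanges are available. The
    exceptional 4-sets become negligible as the dimension [K] of the space of
    types grows. *)
Lemma giraud_scheme (eta : R) : 0 < eta -> \forall n \near \oo%classic,
  exists F U E, scheme 4 n (5 / 16) (1 / 2) (1 : R) eta F U E.
Proof.
move=> e0; have e8 : 0 < eta / 8 by rewrite divr_gt0.
have [N _ hN] := @ffact_ge R 4 0 (eta / 8) e8.
have [M _ hM] := nbhs_infty_ger (8 / eta).
pose K := maxn N M.
pose T := (bool * 'rV['F_2]_K)%type.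
have cX : #|'rV['F_2]_K| = (2 ^ K)%N by rewrite card_mx mul1n card_Fp.
have cT : #|{: T}| = (2 * 2 ^ K)%N by rewrite card_prod card_bool cX.
have Kq : (K < 2 ^ K)%N by exact: ltn_expl.
have cpsi : #|noninj_types K|%:R <= eta / 8 * #|{: T}|%:R ^+ 4 :> R.
  have Nm : (N <= #|{: T}|)%N by rewrite cT; move: (leq_maxl N M); rewrite -/K; lia.
  have := hN _ Nm; rewrite addn0 => h.
  have part : (#|noninj_types K| + #|{: T}| ^_ 4 = #|{: T}| ^ 4)%N.
    have := cardsC [set tau : {ffun 'I_4 -> T} | injectiveb tau]%SET.
    rewrite card_inj_ffuns card_ffun card_ord addnC => <-; congr (_ + _)%N.
    by apply: eq_card => tau; rewrite !inE.
  have {part} : #|noninj_types K|%:R + (#|{: T}| ^_ 4)%:R = #|{: T}|%:R ^+ 4 :> R.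
    by rewrite -natrD part natrX.
  have : 0 <= eta / 8 * #|noninj_types K|%:R by rewrite mulr_ge0 // ltW.
  move: h; move: (#|{: T}|%:R ^+ 4) (#|{: T}| ^_ 4)%:R (#|noninj_types K|%:R : R) => x y z; nra.
have cB : 4%:R <= eta / 2 * #|{: T}|%:R :> R.
  have MT : (M <= #|{: T}|)%N by rewrite cT; move: (leq_maxr N M); rewrite -/K; lia.
  by have := hM _ MT; rewrite /= ler_pdivrMr //; lra.
have cphi : #|giraud_phi K|%:R <= 5 / 16 * #|{: T}|%:R ^+ 4 :> R.
  have := card_giraud_phi K; rewrite -(ler_nat R) => /le_trans; apply.
  rewrite cX cT !natrM !natrX !exprMn; lra.
have pi01 : 0 <= (5 / 16 : R) <= 1 by lra.
have T0 : (0 < #|{: T}|)%N by rewrite cT; lia.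
have := typed_system_scheme T 4 #|'rV['F_2]_K| 2 4 _ _ (5 / 16) eta T0 e0 pi01 cphi cpsi cB.
apply: filterS => n sch.
have [sigma eqs] := @equitable_exists R T (true, 0) n.
exists (giraud_system K n sigma), (odd_one_out K n sigma), (giraud_exc K n sigma).
have := sch sigma _ _ _ eqs (giraud_typed_system K n sigma).
have q0 : (2 ^ K)%:R != 0 :> R by rewrite pnatr_eq0 expn_eq0.
rewrite cX cT natrM divff; last by rewrite -natrM pnatr_eq0 muln_eq0 expn_eq0.
by have -> : (2 ^ K)%:R / (2%:R * (2 ^ K)%:R) = 1 / 2 :> R by field.
Qed.

(** The bound is at least a positive constant, so that additive errors can be
    absorbed in a factor [1 + o(1)]. *)
Lemma main_of_scheme k (p : nat -> R) (pi alpha kappa : R) : (0 < k)%N ->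
  (forall n, 0 <= p n <= 1) -> Theta1 (mean_codeg k.+1 p) ->
  0 < pi <= 1 -> 0 < alpha <= 1 -> 0 < kappa ->
  (forall eta : R, 0 < eta -> \forall n \near \oo%classic,
     exists F U E, scheme k n pi alpha kappa eta F U E) ->
  (forall n, let d := mean_codeg k.+1 p n in beta_r k.+1 d =
     pi * (1 - expR (- (d * (alpha + (1 - alpha) * expR (- (kappa * d))))))) ->
  exists eps : nat -> R,
    (eps n @[n --> \oo%classic] --> (0 : R))%classic /\
    (Hr_pr k.+1 (p n) (fun G : {set {set 'I_n}} =>
       (tau k G)%:R <= (1 + eps n) * beta_r k.+1 (mean_codeg k.+1 p n) * ('C(n, k))%:R)
      @[n --> \oo%classic] --> (1 : R))%classic.
Proof.
move=> k0 p01 hd /andP[pi0 pi1] /andP[a0 a1] kap0 sch betaE.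
have [c [C [c0 C0 dC]]] := hd.
have ca0 : 0 < c * alpha by rewrite mulr_gt0.
apply: (tau_whp k p (fun n => beta_r k.+1 (mean_codeg k.+1 p n)) (pi * (1 - expR (- (c * alpha))))) => //.
- by rewrite mulr_gt0 // subr_gt0 expR_lt1 oppr_lt0.
- apply: filterS dC => n /andP[cd _].
  rewrite betaE ler_wpM2l ?(ltW pi0) // lerD2l lerN2 ler_expR lerN2.
  apply: ler_pM => //; try exact: ltW.
  by rewrite lerDl mulr_ge0 ?expR_ge0 // subr_ge0.
- move=> e e0.
  have pi01 : 0 <= pi <= 1 by rewrite ltW.
  have a01 : 0 <= alpha <= 1 by rewrite ltW.
  apply: filterS (scheme_limit k p pi alpha kappa p01 hd pi01 a01 kap0 sch e e0) => n.
  by rewrite -betaE.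
Qed.

End Assembly.

Local Open Scope classical_set_scope.

Theorem theorem1p13 (R : realType) (r : nat) (p : nat -> R)
  (hr : r \in [:: 3; 4; 5]%N)
  (hp : forall n : nat, 0 <= p n <= 1)
  (hd : Theta1 (mean_codeg r p)) :
  exists eps : nat -> R,
    (eps n @[n --> \oo] --> (0 : R)) /\
    (Hr_pr r (p n) (fun G : {set {set 'I_n}} =>
       (tau r.-1 G)%:R
         <= (1 + eps n) * beta_r r (mean_codeg r p n) * ('C(n, r.-1))%:R)
      @[n --> \oo] --> (1 : R)).
Proof.
move: hr; rewrite !inE => /or3P[] /eqP rE; subst r.
- apply: (main_of_scheme 2 p (1 / 2) (1 / 2) 1 isT hp hd); try lra.
    have pi01 : 0 <= (1 / 2 : R) <= 1 by lra.
    apply: (cyclic_scheme 0 (1 / 2) isT pi01).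
    apply: (@le_trans _ _ 2%:R); first by rewrite ler_nat card_cyclic_phi2.
    lra.
  move=> n /=; congr (_ * (1 - expR _)); rewrite (mul1r (mean_codeg _ _ _)); by field.
- apply: (main_of_scheme 3 p (4 / 9) (2 / 3) 2 isT hp hd); try lra.
    have pi01 : 0 <= (4 / 9 : R) <= 1 by lra.
    apply: (cyclic_scheme 1 (4 / 9) isT pi01).
    apply: (@le_trans _ _ 12%:R); first by rewrite ler_nat card_cyclic_phi3.
    lra.
  move=> n /=; congr (_ * (1 - expR _)); by field.
- apply: (main_of_scheme 4 p (5 / 16) (1 / 2) 1 isT hp hd); try lra.
    exact: giraud_scheme.
  move=> n /=; congr (_ * (1 - expR _)); rewrite (mul1r (mean_codeg _ _ _)); by field.
Qed.
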